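(* For every free $\mathbb{Z}_2$-space $X$ and every integer $n \geq 0$, $$h(X \times_{\mathbb{Z}_2} S^n_b) = h(X) + n.$$
   Context: $\mathbb{Z}_2$ is the cyclic group of order 2 with generator $\tau$. Groups act on spaces from the right unless otherwise stated. An action of a group $\Gamma$ on a space $X$ is called free if every $x \in X$ has a neighborhood $U$ such that $U\gamma \cap U = \emptyset$ for all $\gamma \in \Gamma \setminus \{e_\Gamma\}$; a free $\mathbb{Z}_2$-space is a topological space with a free $\mathbb{Z}_2$-action. For a $\mathbb{Z}_2$-space $X$, $\overline{X}$ denotes its orbit space. For a free $\mathbb{Z}_2$-space $X$, the Stiefel-Whitney height of $X$ is $$h(X) = \sup\{ m \geq 0 \mid w_1(X)^m \neq 0\},$$ where $w_1(X) \in H^1(\overline{X};\mathbb{Z}_2)$ (singular cohomology) is the first Stiefel-Whitney class of the double cover $X \to \overline{X}$ (under $H^1(\overline{X};\mathbb{Z}_2) \cong \mathrm{Hom}(H_1(\overline{X}),\mathbb{Z}_2)$, it is the homomorphism that is $0$ on the class of a loop if the loop lifts to a loop in $X$, and $1$ otherwise). The supremum may be $\infty$, with $\infty + n = \infty$, and $\sup\emptyset = -\infty$ (relevant only for $X = \emptyset$). $S^n_b$ denotes the unit sphere $S^n \subset \mathbb{R}^{n+1}$ with the commuting left and right $\mathbb{Z}_2$-actions $$\tau(x_0,\dots,x_n) = (-x_0,x_1,\dots,x_n), \qquad (x_0,\dots,x_n)\tau = (-x_0,\dots,-x_n).$$ $X \times_{\mathbb{Z}_2} S^n_b$ is the quotient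 of $X \times S^n$ by the relation $(x\tau, y) \sim (x, \tau y)$, with the right $\mathbb{Z}_2$-action $[x,y]\tau = [x, y\tau]$ induced by the right action on $S^n_b$; this is again a free $\mathbb{Z}_2$-space. *)

(* Defs.v *)
From HB Require Import structures.
From Stdlib Require Relation_Operators.
From mathcomp Require Import all_boot all_order all_algebra.
From mathcomp Require Import all_classical all_reals ereal topology normedtype.

Set Implicit Arguments.
Unset Strict Implicit.
Unset Printing Implicit Defensive.

Import Order.TTheory GRing.Theory Num.Theory.
Import numFieldNormedType.Exports.

Local Open Scope classical_set_scope.
Local Open Scope ring_scope.
Local Open Scope quotient_scope.

Definition simplex (R : realType) (n : nat) : set 'rV[R]_n.+1 :=
  [set t | (forall i, 0 <= t ord0 i) /\ \sum_i t ord0 i = 1].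

Arguments simplex : clear implicits.

Section StandardSimplex.
Context {R : realType}.

Lemma vertex_subproof n (i : 'I_n.+1) : delta_mx ord0 i \in simplex R n.
Proof.
rewrite inE; split=> [j|]; first by rewrite mxE ler0n.
rewrite (bigD1 i)//= mxE !eqxx big1 ?addr0// => j /negbTE ji.
by rewrite mxE ji andbF.
Qed.

Definition vertex n (i : 'I_n.+1) : simplex R n :=
  SigSub (vertex_subproof i).

Lemma simplex_map_subproof m n (f : 'I_m.+1 -> 'I_n.+1) (t : simplex R m) :
  \row_j \sum_(i | f i == j) set_val t ord0 i \in simplex R n.
Proof.
have [t0 t1] : simplex R m (set_val t) by exact: set_valP.
rewrite inE; split=> [j|]; first by rewrite mxE sumr_ge0.
under eq_bigr do rewrite mxE.
by rewrite -t1 [RHS](partition_big f xpredT).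
Qed.

(* The affine map sending the vertex [i] to the vertex [f i]. *)
Definition simplex_map m n (f : 'I_m.+1 -> 'I_n.+1) (t : simplex R m) :
  simplex R n := SigSub (simplex_map_subproof f t).

End StandardSimplex.

Section Continuity.
Context {R : realType}.

Lemma continuous_row (T : topologicalType) n (f : T -> 'rV[R]_n) :
  (forall j, continuous (fun x => f x ord0 j)) -> continuous f.
Proof.
move=> cf x A [P fxP sPA].
have : \forall y \near x, forall i j, P i j (f y i j).
  apply: filter_forall => i; apply: filter_forall => j.
  by rewrite ord1; apply: cf; move: (fxP i j); rewrite ord1.
by apply: filterS => y Py; apply: sPA.
Qed.

Lemma continuous_coord (T : topologicalType) n (f : T -> 'rV[R]_n) j :
  continuous f -> continuous (fun x => f x ord0 j).
Proof.
move=> cf x; apply: (@continuous_comp _ _ _ f (fun M : 'rV[R]_n => M ord0 j)).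
  exact: cf.
exact: coord_continuous.
Qed.

Lemma continuous_prod_map (T T' U U' : topologicalType) (f : T -> U)
    (g : T' -> U') :
  continuous f -> continuous g -> continuous (fun p => (f p.1, g p.2)).
Proof.
move=> cf cg [x y] A [[P Q] [/= fP gQ] PQA].
exists (f @^-1` P, g @^-1` Q); first by split; [exact: cf|exact: cg].
by move=> [a b] [/= Pa Qb]; apply: PQA.
Qed.

Lemma continuous_set_val (X : topologicalType) (A : set X) :
  continuous (set_val : A -> X).
Proof. exact: initial_continuous. Qed.

Lemma continuous_set_type (T X : topologicalType) (A : set X) (f : T -> A) :
  continuous (set_val \o f) -> continuous f.
Proof. by move=> cf; exact: continuous_comp_initial. Qed.

Lemma simplex_map_continuous m n (f : 'I_m.+1 -> 'I_n.+1) :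
  continuous (simplex_map f : simplex R m -> simplex R n).
Proof.
apply: continuous_set_type; apply: continuous_row => j x.
rewrite (_ : (fun _ => _) =
    fun t : simplex R m => \sum_(i | f i == j) set_val t ord0 i); last first.
  by apply/funext => t; rewrite /= mxE.
move: x; apply: continuous_big; first exact: add_continuous.
by move=> i _; apply: continuous_coord; exact: continuous_set_val.
Qed.

HB.instance Definition _ m n (f : 'I_m.+1 -> 'I_n.+1) :=
  isContinuous.Build (simplex R m) (simplex R n) (simplex_map f)
    (@simplex_map_continuous m n f).

End Continuity.

Section Singular.
Context {R : realType} {Y : topologicalType}.

Definition singular (n : nat) := continuousType (simplex R n) Y.

Definition pullback m n (f : 'I_m.+1 -> 'I_n.+1) (s : singular n) :
  singular m := s \o simplex_map f.

Lemma eq_pullback m n (f g : 'I_m.+1 -> 'I_n.+1) (s : singular n) :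
  f =1 g -> pullback f s = pullback g s.
Proof. by move=> /funext ->. Qed.

Lemma pullback_comp l m n (f : 'I_m.+1 -> 'I_n.+1) (g : 'I_l.+1 -> 'I_m.+1)
    (s : singular n) :
  pullback g (pullback f s) = pullback (f \o g) s.
Proof.
apply/continuousEP => t; rewrite /pullback /=; congr (s _).
apply/val_inj/rowP => j; rewrite !mxE /=.
rewrite [RHS](partition_big g (fun i => f i == j))//=.
apply: eq_bigr => i /eqP fij; rewrite mxE; apply: eq_bigl => k.
by case: (g k =P i) => [->|]; rewrite ?andbF// fij eqxx.
Qed.

Definition cochain (n : nat) := singular n -> 'F_2.

HB.instance Definition _ n := GRing.Zmodule.on (cochain n).

(* No signs are needed, the coefficients having characteristic 2. *)
Definition cobound n (c : cochain n) : cochain n.+1 :=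
  fun s => \sum_(i < n.+2) c (pullback (lift i) s).

Lemma cobound_is_zmod_morphism n : zmod_morphism (@cobound n).
Proof. by move=> c d; apply/funext => s; exact: sumrB. Qed.

HB.instance Definition _ n :=
  GRing.isZmodMorphism.Build (cochain n) (cochain n.+1) (@cobound n)
    (@cobound_is_zmod_morphism n).

Definition is_cocycle n : {pred cochain n} := fun c => cobound c == 0.

Lemma is_cocycle_zmod_closed n : zmod_closed (@is_cocycle n).
Proof.
split=> [|c d]; rewrite !unfold_in /is_cocycle ?raddf0// raddfB.
by move=> /eqP c0 /eqP d0 /=; rewrite c0 d0 subrr.
Qed.

HB.instance Definition _ n :=
  GRing.isZmodClosed.Build (cochain n) (@is_cocycle n)
    (@is_cocycle_zmod_closed n).

Record cocycle n := Cocycle { cocycle_val :> cochain n;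
                              cocycleP : cocycle_val \in @is_cocycle n }.

HB.instance Definition _ n := [isSub for @cocycle_val n].
HB.instance Definition _ n := [Choice of cocycle n by <:].
HB.instance Definition _ n := [SubChoice_isSubZmodule of cocycle n by <:].

Definition is_coboundary n : cochain n -> Prop :=
  match n return cochain n -> Prop with
  | 0 => fun c => c = 0
  | m.+1 => fun c => exists b : cochain m, c = cobound b
  end.

Definition coboundary n : {pred cocycle n} :=
  fun z => `[< is_coboundary (val z) >].

Lemma coboundary_zmod_closed n : zmod_closed (@coboundary n).
Proof.
case: n => [|n]; split=> [|x y]; rewrite !unfold_in /coboundary /=.
- exact/asboolP.
- by move=> /asboolP x0 /asboolP y0; apply/asboolP; rewrite x0 y0 subrr.
- by apply/asboolP; exists 0; rewrite raddf0.
- move=> /asboolP[b xb] /asboolP[c yc]; apply/asboolP.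
  by exists (b - c); rewrite raddfB /= xb yc.
Qed.

HB.instance Definition _ n :=
  GRing.isZmodClosed.Build (cocycle n) (@coboundary n)
    (@coboundary_zmod_closed n).

Definition cohomology n := Quotient.quot (@coboundary n).

HB.instance Definition _ n := EqQuotient.on (cohomology n).
HB.instance Definition _ n := GRing.Zmodule.on (cohomology n).

Definition front p q : 'I_p.+1 -> 'I_(p + q).+1 := fun i => inord i.
Definition back p q : 'I_q.+1 -> 'I_(p + q).+1 := fun i => inord (p + i).

Definition cup p q (c : cochain p) (d : cochain q) : cochain (p + q) :=
  fun s => c (pullback (@front p q) s) * d (pullback (@back p q) s).

Lemma cup_cocycle_subproof p q (c : cocycle p) (d : cocycle q) :
  cup c d \in @is_cocycle (p + q).
Proof.
have F2 : 2%N \in [pchar 'F_2] by rewrite pchar_Fp.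
have bumpl i k : (k < i)%N -> bump i k = k.
  by move=> ki; rewrite /bump leqNgt ki.
have bumpr i k : (i <= k)%N -> bump i k = k.+1 by move=> ik; rewrite /bump ik.
rewrite unfold_in; apply/eqP/funext => s.
pose A i := val c (pullback (fun k => inord (bump i k)) s).
pose D i := val d (pullback (fun k => inord (bump i (p + k))) s).
pose f := val c (pullback (fun k => inord k) s).
pose b := val d (pullback (fun k => inord (p.+1 + k)) s).
have lift_inord n (i : 'I_n.+2) (k : nat) : (k <= n)%N ->
    lift i (inord k : 'I_n.+1) = inord (bump i k).
  move=> kn; apply/val_inj => /=; rewrite inordK// inordK// /bump.
  by case: (i <= k)%N; rewrite ltnS// leqW.
have -> : cobound (cup c d) s = \sum_(0 <= i < (p + q).+2) A i * D i.
  rewrite big_mkord; apply: eq_bigr => i _; rewrite /cup !pullback_comp.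
  congr (val c _ * val d _); apply: eq_pullback => k /=; rewrite lift_inord//.
    by rewrite (leq_trans _ (leq_addr _ _))// -ltnS.
  by rewrite leq_add2l -ltnS.
have Af : \sum_(0 <= i < p.+1) A i = f.
  have := eqP (cocycleP c) => /(congr1 (@^~ (pullback (@front p.+1 q) s))).
  rewrite /cobound big_ord_recr/= => /eqP.
  rewrite [X in _ == X](_ : _ = 0)// addr_eq0 (oppr_pchar2 F2) => /eqP cF.
  rewrite big_mkord; transitivity (\sum_(i < p.+1) val c (pullback
      (lift (widen_ord (leqnSn p.+1) i)) (pullback (@front p.+1 q) s))).
    by apply: eq_bigr => i _; rewrite pullback_comp; congr (val c _).
  apply: (etrans cF); rewrite pullback_comp; congr (val c _).
  apply: (@eq_pullback p (p + q).+1) => k.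
  by rewrite /front /= bumpl.
have Db : \sum_(p.+1 <= i < (p + q).+2) D i = b.
  pose G := pullback (fun j : 'I_q.+2 => inord (p + j) : 'I_(p + q).+2) s.
  have := eqP (cocycleP d) => /(congr1 (@^~ G)).
  rewrite /cobound big_ord_recl/= => /eqP.
  rewrite [X in _ == X](_ : _ = 0)// addrC addr_eq0 (oppr_pchar2 F2) => /eqP dG.
  rewrite -{1}[p.+1]add0n big_addn subSS -addnS addKn big_mkord.
  transitivity (\sum_(i < q.+1) val d (pullback (lift (lift ord0 i)) G)).
    apply: eq_bigr => i _; rewrite pullback_comp; congr (val d _).
    apply: eq_pullback => k /=; congr inord.
    by rewrite /bump /= [(i + _)%N]addnC addSnnS leq_add2l /bump add1n addnCA.
  apply: (etrans dG); rewrite pullback_comp; congr (val d _).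
  by apply: eq_pullback => k /=; rewrite /bump /= add1n addnS.
rewrite (@big_cat_nat _ _ _ p.+1)//=; last first.
  by rewrite ltnS (leq_trans (leq_addr q p)).
rewrite (@eq_big_nat _ _ _ 0 _ _ (fun i => A i * b)); last first.
  move=> i /andP[_ ip]; congr (_ * val d _); apply: eq_pullback => k.
  by rewrite bumpr// (leq_trans _ (leq_addr _ _)).
rewrite (@eq_big_nat _ _ _ p.+1 _ _ (fun i => f * D i)); last first.
  move=> i /andP[ip _]; congr (val c _ * _); apply: eq_pullback => k.
  by rewrite bumpl// (leq_trans _ ip).
by rewrite -mulr_suml -mulr_sumr Af Db (addrr_pchar2 F2).
Qed.

Definition cup_cocycle p q (c : cocycle p) (d : cocycle q) :
  cocycle (p + q) := Cocycle (cup_cocycle_subproof c d).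

(* The class does not depend on the representatives, by the Leibniz rule. *)
Definition cohomology_cup p q (a : cohomology p) (b : cohomology q) :
  cohomology (p + q) :=
  \pi_(cohomology (p + q)) (cup_cocycle (repr a) (repr b)).

Lemma unit_cocycle_subproof : (fun _ => 1) \in @is_cocycle 0.
Proof.
rewrite unfold_in; apply/eqP/funext => s.
by rewrite /cobound !big_ord_recl big_ord0; apply/val_inj.
Qed.

Definition cohomology_unit : cohomology 0 :=
  \pi_(cohomology 0) (Cocycle unit_cocycle_subproof).

Fixpoint cohomology_exp (w : cohomology 1) (m : nat) : cohomology m :=
  match m return cohomology m with
  | 0 => cohomology_unit
  | m'.+1 => cohomology_cup w (cohomology_exp w m')
  end.

Definition is_loop (s : singular 1) := s (vertex ord0) = s (vertex ord_max).

End Singular.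
Arguments singular : clear implicits.
Arguments cohomology : clear implicits.

(* An action of Z_2 is given by the action of its generator tau, which is the
   only element different from the identity. *)
Record freeZ2Space := FreeZ2Space {
  z2_sort :> topologicalType;
  z2_act : z2_sort -> z2_sort;
  z2_act_continuous : continuous z2_act;
  z2_actK : involutive z2_act;
  z2_act_free : forall x : z2_sort,
    exists2 U : set z2_sort, nbhs x U & z2_act @` U `&` U = set0
}.

Section OrbitSpace.
Variable X : freeZ2Space.

Definition orbit_rel : rel X := fun x y => (y == x) || (y == z2_act x).

Lemma orbit_rel_refl : reflexive orbit_rel.
Proof. by move=> x; rewrite /orbit_rel eqxx. Qed.

Lemma orbit_rel_sym : symmetric orbit_rel.
Proof.
move=> x y; rewrite /orbit_rel [y == x]eq_sym; congr (_ || _).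
by rewrite -(can_eq (@z2_actK X)) z2_actK eq_sym.
Qed.

Lemma orbit_rel_trans : transitive orbit_rel.
Proof.
move=> y x z /orP[/eqP -> //|/eqP ->] /orP[/eqP ->|/eqP ->].
  by rewrite /orbit_rel eqxx orbT.
by rewrite z2_actK orbit_rel_refl.
Qed.

Canonical orbit_equiv_rel :=
  EquivRel orbit_rel orbit_rel_refl orbit_rel_sym orbit_rel_trans.

Definition orbit_space := quotient_topology {eq_quot orbit_equiv_rel}.

End OrbitSpace.

Section StiefelWhitney.
Variables (R : realType) (X : freeZ2Space).

Definition lifts_to_loop (s : singular R (orbit_space X) 1) : Prop :=
  exists2 l : singular R X 1, is_loop l & \pi_(orbit_space X) \o l =1 s.

(* Loops generate H_1, so that a class in H^1 = Hom(H_1, F_2) is determined by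
   its values on them; the value on a loop of a cocycle depends only on the
   cohomology class of the cocycle. *)
Definition is_w1 (w : cohomology R (orbit_space X) 1) : Prop :=
  forall s : singular R (orbit_space X) 1, is_loop s ->
    val (repr w) s = if `[< lifts_to_loop s >] then 0 else 1.

(* There is exactly one class satisfying [is_w1]; [0] is a dummy default. *)
Definition w1 : cohomology R (orbit_space X) 1 := xget 0 [set w | is_w1 w].

(* The supremum is taken in the extended reals, so that it is +oo if the set is
   unbounded and -oo if it is empty. *)
Definition sw_height : \bar R :=
  ereal_sup [set m%:R%:E | m in [set m : nat | cohomology_exp w1 m != 0]].

End StiefelWhitney.

Definition sphere (R : realType) (n : nat) : set 'rV[R]_n.+1 :=
  [set x | \sum_i x ord0 i ^+ 2 = 1].
Arguments sphere : clear implicits.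

Section BalancedProduct.
Variables (R : realType) (X : freeZ2Space) (n : nat).
Local Notation S := (sphere R n).

Lemma sphere_left_subproof (y : S) :
  \row_i (if i == ord0 then - set_val y ord0 i else set_val y ord0 i) \in S.
Proof.
have yS : S (set_val y) by exact: set_valP.
rewrite inE /sphere /= -[RHS]yS; apply: eq_bigr => i _; rewrite mxE.
by case: ifP; rewrite ?sqrrN.
Qed.

Definition sphere_left (y : S) : S := SigSub (sphere_left_subproof y).

Lemma sphere_right_subproof (y : S) : - set_val y \in S.
Proof.
have yS : S (set_val y) by exact: set_valP.
by rewrite inE /sphere /= -[RHS]yS; apply: eq_bigr => i _; rewrite mxE sqrrN.
Qed.

Definition sphere_right (y : S) : S := SigSub (sphere_right_subproof y).

Lemma sphere_leftK : involutive sphere_left.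
Proof.
move=> y; apply/val_inj/rowP => i; rewrite mxE set_valE /= mxE set_valE.
by case: (i == ord0); rewrite ?opprK.
Qed.

Lemma sphere_rightK : involutive sphere_right.
Proof. by move=> y; apply/val_inj; rewrite /= opprK. Qed.

Lemma sphere_leftC y :
  sphere_left (sphere_right y) = sphere_right (sphere_left y).
Proof.
by apply/val_inj/rowP => i; rewrite !mxE /=; case: ifP.
Qed.

Lemma sphere_left_continuous : continuous sphere_left.
Proof.
apply: continuous_set_type; apply: continuous_row => j.
have c : continuous (fun y : S => set_val y ord0 j).
  by apply: continuous_coord; exact: continuous_set_val.
rewrite (_ : (fun _ => _) = if j == ord0 then fun y : S => - set_val y ord0 j
  else fun y : S => set_val y ord0 j); last first.
  by apply/funext => y; rewrite /= mxE; case: ifP.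
case: ifP => _; last exact: c.
by move=> y; exact: (cvgN (c y)).
Qed.

Lemma sphere_right_continuous : continuous sphere_right.
Proof.
apply: continuous_set_type => y.
exact: (cvgN (@continuous_set_val _ S y)).
Qed.

Definition balanced_step (p q : X * S) : Prop :=
  exists x y, p = (z2_act x, y) /\ q = (x, sphere_left y).

Definition balanced_rel : rel (X * S) := fun p q =>
  `[< Relation_Operators.clos_refl_sym_trans _ balanced_step p q >].

Lemma balanced_rel_refl : reflexive balanced_rel.
Proof. by move=> p; apply/asboolP/Relation_Operators.rst_refl. Qed.

Lemma balanced_rel_sym : symmetric balanced_rel.
Proof.
by move=> p q; apply/asboolP/asboolP; exact: Relation_Operators.rst_sym.
Qed.

Lemma balanced_rel_trans : transitive balanced_rel.
Proof.
move=> q p r /asboolP pq /asboolP qr; apply/asboolP.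
exact: Relation_Operators.rst_trans pq qr.
Qed.

Canonical balanced_equiv_rel :=
  EquivRel balanced_rel balanced_rel_refl balanced_rel_sym balanced_rel_trans.

Definition balanced_space := quotient_topology {eq_quot balanced_equiv_rel}.

Lemma balanced_relE p q :
  balanced_rel p q = (q == p) || (q == (z2_act p.1, sphere_left p.2)).
Proof.
apply/asboolP/orP => [|[]/eqP ->].
- elim=> {p q} [_ _ [x [y [-> ->]]]|p|p q _ []/eqP ->|
    p q r _ [] /eqP -> _ []/eqP ->];
    rewrite /= ?z2_actK ?sphere_leftK -?surjective_pairing;
    by [left|right].
- exact: Relation_Operators.rst_refl.
- apply: Relation_Operators.rst_step; exists (z2_act p.1), p.2.
  by rewrite z2_actK -surjective_pairing.
Qed.

Lemma pi_balancedP p q : \pi_balanced_space p = \pi_balanced_space q <->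
  q = p \/ q = (z2_act p.1, sphere_left p.2).
Proof.
split=> [/eqmodP|pq]; last apply/eqmodP; rewrite /= balanced_relE.
  by case/orP => /eqP; [left|right].
by apply/orP; case: pq => ->; [left|right].
Qed.

Definition balanced_act (q : balanced_space) : balanced_space :=
  \pi_balanced_space ((repr q).1, sphere_right (repr q).2).

Lemma balanced_act_pi x y : balanced_act (\pi_balanced_space (x, y)) =
  \pi_balanced_space (x, sphere_right y).
Proof.
rewrite /balanced_act; have := reprK (\pi_balanced_space (x, y)).
move: (repr _) => r /pi_balancedP xy; apply/pi_balancedP.
by case: xy => [<-|[-> ->]]; [left|right; rewrite sphere_leftC].
Qed.

Lemma balanced_ind (P : balanced_space -> Prop) :
  (forall x y, P (\pi_balanced_space (x, y))) -> forall q, P q.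
Proof. by move=> Pxy q; rewrite -[q]reprK [repr q]surjective_pairing. Qed.

Lemma balanced_actK : involutive balanced_act.
Proof. by elim/balanced_ind => x y; rewrite !balanced_act_pi sphere_rightK. Qed.

Lemma balanced_act_continuous : continuous balanced_act.
Proof.
apply/quotient_continuous.
rewrite (_ : _ \o _ = \pi_balanced_space \o
    (fun p => (p.1, sphere_right p.2))); last first.
  by apply/funext => -[x y]; rewrite /= balanced_act_pi.
move=> p; apply: continuous_comp; last exact: pi_continuous.
exact: (@continuous_prod_map _ _ _ _ id _ (fun=> cvg_id)
  sphere_right_continuous).
Qed.

Lemma balanced_act_free (q : balanced_space) :
  exists2 U : set balanced_space, nbhs q U & balanced_act @` U `&` U = set0.
Proof.
elim/balanced_ind: q => x y.
have [U xU UU] := z2_act_free x.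
have [i yi] : exists i, set_val y ord0 i != 0.
  apply: contrapT => /forallNP y0.
  have /eqP : S (set_val y) by exact: set_valP.
  rewrite big1 1?eq_sym ?oner_eq0// => i _.
  by have /negP/negPn/eqP -> := y0 i; rewrite expr0n.
pose B := [set z : S | 0 < set_val z ord0 i * set_val y ord0 i].
have oB : open B.
  have /continuousP :
      continuous (fun z : S => set_val z ord0 i * set_val y ord0 i).
    have ci : continuous (fun z : S => set_val z ord0 i).
      by apply: continuous_coord; exact: continuous_set_val.
    by move=> z; exact: (cvgM (ci z) (@cvg_cst _ _ _ _ _)).
  by move=> /(_ _ (@open_gt R 0)).
pose W : set (X * S) := U° `*` B.
have oW : open W.
  rewrite openE => -[a b] [/= Ua Bb]; exists (U°, B) => //=.
  by split; apply: open_nbhs_nbhs; split => //; exact: open_interior.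
pose sigma (p : X * S) := (z2_act p.1, sphere_left p.2).
have csigma : continuous sigma.
  apply: continuous_prod_map; first exact: z2_act_continuous.
  exact: sphere_left_continuous.
exists (\pi_balanced_space @` W).
  apply: open_nbhs_nbhs; split; last first.
    exists (x, y) => //; split=> //=.
    by rewrite /B/= -expr2 exprn_even_gt0.
  rewrite /open/= /quotient_open.
  rewrite (_ : _ @^-1` _ = W `|` sigma @^-1` W).
    by apply: openU => //; move/continuousP: csigma; apply.
  apply/seteqP; split=> p /=.
    move=> [r Wr /esym/pi_balancedP[<-|rE]]; [by left|right].
    by rewrite /sigma -rE.
  case=> Wp; first by exists p.
  by exists (sigma p) => //; apply/esym/pi_balancedP; right.
apply/seteqP; split=> // _ [[_ [[a b] [/= Ua Bb] <-] <-]].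
rewrite balanced_act_pi.
move=> -[[a' b'] [/= Ua' Bb'] /esym/pi_balancedP[]/= [aE bE]].
  move: Bb Bb'; rewrite /B bE /= mxE mulNr oppr_gt0 => /ltW.
  by rewrite leNgt => /negP.
have : (@z2_act X @` U `&` U) (z2_act a).
  split; first by exists a => //; exact: interior_subset.
  by rewrite -aE; exact: interior_subset.
by rewrite UU.
Qed.

Definition balanced_product : freeZ2Space :=
  FreeZ2Space balanced_act_continuous balanced_actK balanced_act_free.

End BalancedProduct.

(* Main.v *)
(* An odd function chi : X -> F_2, i.e. one with chi(x tau) = chi(x) + 1, gives
   a cocycle representing w_1(X): compare the values of chi at the two ends of
   a lift of a path. This uses unique lifting of simplices to X. Below, t and w
   are the classes of Y = X x_{Z_2} S^n_b and of X.

   Upper bound. For i > 0 the sign of the coordinate y_i is essentially an odd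
   function on Y, and its cocycle t_i vanishes on simplices on which y_i never
   vanishes; likewise y_0 yields a cocycle of t + w vanishing on simplices on
   which y_0 never vanishes. So every product containing t_1, ..., t_n and that
   cocycle vanishes on all simplices small with respect to the open cover by the
   sets {y_i <> 0}, hence is a coboundary by barycentric subdivision. Replacing
   factors t by w one at a time, t^(n+k) = t_1 ... t_n w^k, which is zero if
   w^k is.

   Lower bound, by induction on n: X x_{Z_2} S^(n+1)_b is the fibrewise
   suspension of Y. Map a simplex of the orbit space of Y to the sum of the
   prisms joining its two lifts to the pole. This is a chain map of degree 1, as
   the two tops agree and the two bottoms agree modulo Z_2, and for an odd
   function vanishing at the pole it pulls the cocycle of t^(k+1) back to that of
   t^k. *)
From HB Require Import structures.
Require Import Defs.
From mathcomp Require Import all_boot all_order all_algebra.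
From mathcomp Require Import all_classical all_reals ereal topology normedtype.
From mathcomp Require Import sequences ring.

Set Implicit Arguments.
Unset Strict Implicit.
Unset Printing Implicit Defensive.

Import Order.TTheory GRing.Theory Num.Theory.
Import numFieldNormedType.Exports.

Local Open Scope classical_set_scope.
Local Open Scope ring_scope.
Local Open Scope quotient_scope.

(** * Cochains on lists of vertices *)

Section ListCochains.

Lemma addF2 (a : 'F_2) : a + a = 0.
Proof. by rewrite addrr_pchar2// pchar_Fp. Qed.

Lemma oppF2 (a : 'F_2) : - a = a.
Proof. by rewrite oppr_pchar2// pchar_Fp. Qed.

Lemma F2P (a : 'F_2) : a = 0 \/ a = 1.
Proof. by case: a => -[|[|//]] i; [left|right]; apply/val_inj. Qed.

Lemma addF2_eq0 (a b : 'F_2) : a + b = 0 -> a = b.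
Proof. by move/eqP; rewrite addr_eq0 oppF2 => /eqP. Qed.

Variable V : Type.
Implicit Types (g : seq V -> 'F_2) (l : seq V) (x : V).

(* Chains on ordered vertices appear only through their duals: for a function [g]
   on lists, [dl g], [Sd g], [Td g] and [prism g] evaluate [g] on the boundary, on
   the barycentric subdivision (with barycentres [b]), on the homotopy from it to
   the identity, and on the prism with bottom [l, false] and top [l, true]. The
   boundary of a one-vertex list is the empty list. *)
Fixpoint dl g l : 'F_2 :=
  if l is x :: l' then g l' + dl (fun k => g (x :: k)) l' else 0.

Lemma eq_dl g h l :
  (forall k, size k = (size l).-1 -> g k = h k) -> dl g l = dl h l.
Proof.
elim: l g h => //= x l IH g h gh; congr (_ + _); first exact: gh.
case: l IH gh => // y l IH gh.
by apply: IH => k kl; apply: gh; rewrite /= kl.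
Qed.

Lemma dlD g h l : dl (fun k => g k + h k) l = dl g l + dl h l.
Proof.
elim: l g h => [|x l IH] g h /=; first by rewrite addr0.
by rewrite IH addrACA.
Qed.

Lemma dl0 l : dl (fun=> 0) l = 0.
Proof. by elim: l => //= x l ->; rewrite addr0. Qed.

Lemma dl_sum I (r : seq I) (P : pred I) (G : I -> seq V -> 'F_2) l :
  dl (fun k => \sum_(i <- r | P i) G i k) l = \sum_(i <- r | P i) dl (G i) l.
Proof.
elim: l G => [|x l IH] G /=; first by rewrite big1.
by rewrite IH -big_split.
Qed.

Lemma dl_cons g x l : dl g (x :: l) = g l + dl (fun k => g (x :: k)) l.
Proof. by []. Qed.

Lemma dl_cons2 g x y l :
  dl g [:: x, y & l] = g (y :: l) + (g (x :: l) + dl (fun k => g [:: x, y & k]) l).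
Proof. by []. Qed.

Lemma dlMl a g l : dl (fun k => a * g k) l = a * dl g l.
Proof. by elim: l g => [|x l IH] g /=; rewrite ?mulr0// IH mulrDr. Qed.

Lemma dl_dl g l : dl (dl g) l = 0.
Proof.
elim: l g => //= x l IH g.
by rewrite dlD IH addr0 addF2.
Qed.

Definition del (i : nat) l := take i l ++ drop i.+1 l.

Lemma dlE g l : dl g l = \sum_(i < size l) g (del i l).
Proof.
elim: l g => [|x l IH] g /=; first by rewrite big_ord0.
by rewrite big_ord_recl /= {1}/del /= drop0 IH.
Qed.

Variable b : seq V -> V.

Fixpoint Sd n g l : 'F_2 :=
  if n is m.+1 then dl (Sd m (fun k => g (b l :: k))) l else g l.

Fixpoint Td n g l : 'F_2 :=
  if n is m.+1 then g (b l :: l) + dl (Td m (fun k => g (b l :: k))) l else 0.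

Lemma eq_Sd n g h l : size l = n -> (forall k, size k = n -> g k = h k) ->
  Sd n g l = Sd n h l.
Proof.
elim: n g h l => [|n IH] g h l /= ln gh; first exact: gh.
apply: eq_dl => k kl; apply: IH; first by rewrite kl ln.
by move=> k' k'n; apply: gh; rewrite /= k'n.
Qed.

Lemma eq_Td n g h l : size l = n -> (forall k, size k = n.+1 -> g k = h k) ->
  Td n g l = Td n h l.
Proof.
elim: n g h l => [|n IH] g h l //= ln gh; congr (_ + _).
  by apply: gh; rewrite /= ln.
apply: eq_dl => k kl; apply: IH; first by rewrite kl ln.
by move=> k' k'n; apply: gh; rewrite /= k'n.
Qed.

Lemma SdD n g h l : Sd n (fun k => g k + h k) l = Sd n g l + Sd n h l.
Proof.
elim: n g h l => [//|n IH] g h l /=; rewrite -dlD.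
by apply: eq_dl => k _; rewrite IH.
Qed.

Lemma TdD n g h l : Td n (fun k => g k + h k) l = Td n g l + Td n h l.
Proof.
elim: n g h l => [|n IH] g h l /=; first by rewrite addr0.
by rewrite addrACA -dlD; congr (_ + _); apply: eq_dl => k _; rewrite IH.
Qed.

Lemma Sd0 n l : Sd n (fun=> 0) l = 0.
Proof.
elim: n l => //= n IH l; rewrite -[RHS](dl0 l).
exact: eq_dl.
Qed.

Lemma Td0 n l : Td n (fun=> 0) l = 0.
Proof.
elim: n l => //= n IH l; rewrite add0r -[RHS](dl0 l).
exact: eq_dl.
Qed.

Lemma dl_Sd n g l : size l = n.+1 -> dl (Sd n g) l = Sd n.+1 (dl g) l.
Proof.
elim: n g l => [|n IH] g l ln.
  by case: l ln => [|x []]//= _; rewrite !addr0.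
rewrite [RHS]/=; set gb := fun k => g (b l :: k).
transitivity (dl (fun k => Sd n.+1 g k + dl (Sd n gb) k) l).
  by rewrite dlD dl_dl addr0.
by apply: eq_dl => k; rewrite ln => kn; rewrite IH// -SdD.
Qed.

Lemma Td_homotopy n g l : size l = n ->
  Td n (dl g) l + dl (Td n.-1 g) l = g l + Sd n g l.
Proof.
elim: n g l => [|n IH] g l ln.
  by case: l ln => //= _; rewrite addr0 addF2.
rewrite [Td _ _ _]/= [Sd _ _ _]/=.
set gb := fun k => g (b l :: k).
have -> : dl (Td n (fun k => g k + dl gb k)) l =
    dl (Td n g) l + (dl gb l + dl (Sd n gb) l).
  rewrite -!dlD -[RHS]addr0 -(dl_dl (Td n.-1 gb) l) -dlD.
  apply: eq_dl => k; rewrite ln => kn; rewrite TdD -!addrA; congr (_ + _).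
  by rewrite addrA -IH// -addrA addF2 addr0.
rewrite -/gb; move: (g l) (dl gb l) (dl (Td n g) l) (dl (Sd n gb) l) => x y z t.
by case: (F2P x) (F2P y) (F2P z) (F2P t) => -> [] -> [] -> [] ->; apply/val_inj.
Qed.

Lemma dl_iter_Sd n g M l : (forall k, size k = n.+1 -> dl g k = 0) ->
  size l = n.+1 -> dl (iter M (Sd n) g) l = 0.
Proof.
move=> g0; elim: M l => [|M IH] l ln; first exact: g0.
rewrite iterS dl_Sd// -[RHS](Sd0 n.+1 l).
exact: eq_Sd.
Qed.

Lemma Td_sum_homotopy n g M l : size l = n ->
  (forall k, size k = n.+1 -> dl g k = 0) ->
  dl (fun k => \sum_(j < M) Td n.-1 (iter j (Sd n) g) k) l =
  g l + iter M (Sd n) g l.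
Proof.
move=> ln g0; rewrite dl_sum; elim: M => [|M IH].
  by rewrite big_ord0 addF2.
rewrite big_ord_recr/= IH.
have := Td_homotopy (iter M (Sd n) g) ln.
rewrite (@eq_Td _ _ (fun=> 0))// ?Td0 ?add0r => [->|k kn].
  by rewrite addrA -[g l + _ + _]addrA addF2 addr0.
exact: dl_iter_Sd.
Qed.

End ListCochains.

Section Naturality.
Variables (V W : Type) (f : V -> W).
Implicit Types (g : seq W -> 'F_2) (l : seq V).

Lemma dl_map g l : dl (fun k => g (map f k)) l = dl g (map f l).
Proof. by elim: l g => //= x l IH g; rewrite -IH. Qed.

Variables (b : seq V -> V) (b' : seq W -> W).
Hypothesis bf : forall l, l <> [::] -> f (b l) = b' (map f l).

Lemma Sd_map n g l : size l = n ->
  Sd b n (fun k => g (map f k)) l = Sd b' n g (map f l).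
Proof.
elim: n g l => [//|n IH] g l ln /=.
have l0 : l <> [::] by move=> l0; rewrite l0 in ln.
rewrite -(dl_map _ l); apply: eq_dl => k; rewrite ln => kn.
by rewrite -IH//=; apply: eq_Sd => // k' _ /=; rewrite bf.
Qed.

Lemma Td_map n g l : size l = n ->
  Td b n (fun k => g (map f k)) l = Td b' n g (map f l).
Proof.
elim: n g l => [//|n IH] g l ln /=.
have l0 : l <> [::] by move=> l0; rewrite l0 in ln.
rewrite bf//; congr (_ + _).
rewrite -(dl_map _ l); apply: eq_dl => k; rewrite ln => kn.
by rewrite -IH//=; apply: eq_Td => // k' _ /=; rewrite bf.
Qed.

Lemma iter_Sd_map n g j l : size l = n ->
  iter j (Sd b n) (fun k => g (map f k)) l = iter j (Sd b' n) g (map f l).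
Proof.
elim: j l => //= j IH l ln; rewrite -Sd_map//.
exact: eq_Sd.
Qed.

End Naturality.

Section Vanishing.
Variables (V : eqType) (b : seq V -> V).
Implicit Types (g : seq V -> 'F_2) (l : seq V) (C : pred V).

Lemma dl_eq0 g l :
  (forall k, {subset k <= l} -> size k = (size l).-1 -> g k = 0) ->
  dl g l = 0.
Proof.
elim: l g => //= x l IH g g0; rewrite g0 ?add0r//; last first.
  by move=> y yl; rewrite inE yl orbT.
case: l IH g0 => // y l IH g0.
apply: IH => k kl ks; apply: g0; last by rewrite /= ks.
by move=> z; rewrite !inE => /orP[->//|/kl]; rewrite inE => ->; rewrite orbT.
Qed.

Definition bclosed C := forall l, l != [::] -> {subset l <= C} -> b l \in C.

Lemma Td_eq0 C n g l : bclosed C -> {subset l <= C} -> size l = n ->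
  (forall k, {subset k <= C} -> size k = n.+1 -> g k = 0) -> Td b n g l = 0.
Proof.
move=> bC; elim: n g l => //= n IH g l lC ln g0.
have blC : b l \in C by apply: bC => //; case: (l) ln.
rewrite g0 ?add0r//=; first last.
- by rewrite ln.
- by move=> x; rewrite inE => /orP[/eqP->|/lC].
apply: dl_eq0 => k kl; rewrite ln/= => kn; apply: IH => //.
  by move=> x /kl /lC.
move=> k' k'C k'n; apply: g0; last by rewrite /= k'n.
by move=> x; rewrite inE => /orP[/eqP->|/k'C].
Qed.

End Vanishing.

Section Prism.
Variable A : Type.
Implicit Types (g : seq (A * bool) -> 'F_2) (l : seq A).

Definition level (e : bool) l : seq (A * bool) := [seq (a, e) | a <- l].

Fixpoint prism g l : 'F_2 :=
  if l is a :: l' then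
    g ((a, false) :: (a, true) :: level true l') +
    prism (fun k => g ((a, false) :: k)) l'
  else 0.

Lemma eq_prism g h l : (forall k, size k = (size l).+1 -> g k = h k) ->
  prism g l = prism h l.
Proof.
elim: l g h => //= a l IH g h gh; congr (_ + _).
  by apply: gh; rewrite /= size_map.
by apply: IH => k kl; apply: gh; rewrite /= kl.
Qed.

Lemma prismD g h l : prism (fun k => g k + h k) l = prism g l + prism h l.
Proof.
elim: l g h => [|a l IH] g h /=; first by rewrite addr0.
by rewrite IH addrACA.
Qed.

Lemma prism_homotopy g l :
  prism (dl g) l = dl (prism g) l + (g (level true l) + g (level false l)).
Proof.
elim: l g => [|a l IH] g; first by rewrite /= addF2 addr0.
pose g0 k := g ((a, false) :: k).
pose g01 k := g ((a, false) :: (a, true) :: k).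
transitivity (g ((a, true) :: level true l) + (g0 (level true l) +
    dl g01 (level true l)) + (prism g l + prism (dl g0) l)).
  by rewrite -prismD.
transitivity (prism g l + (dl g01 (level true l) + dl (prism g0) l) +
    (g ((a, true) :: level true l) + g0 (level false l))); last first.
  by rewrite -dl_map -dlD.
rewrite IH -/(g0 _).
move: (g _) (g0 _) (g0 _) (dl g01 _) (prism g l) (dl _ l) => p q r x y z.
case: (F2P p) (F2P q) (F2P r) (F2P x) (F2P y) (F2P z) => -> [] -> [] -> [] ->.
all: by case=> -> [] ->; apply/val_inj.
Qed.

Lemma prismMl x g l : prism (fun k => x * g k) l = x * prism g l.
Proof. by elim: l g => [|a l IH] g /=; rewrite ?mulr0// IH mulrDr. Qed.

End Prism.

Lemma prism_map (A B : Type) (f : A -> B) g l :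
  prism g (map f l) = prism (fun q => g [seq (f x.1, x.2) | x <- q]) l.
Proof.
elim: l g => //= a l IH g; rewrite IH; congr (g (_ :: _ :: _) + _).
by rewrite /level -!map_comp.
Qed.

Fixpoint diff_prod (V : Type) (h : V -> 'F_2) (l : seq V) : 'F_2 :=
  if l is x :: l' then
    if l' is y :: _ then (h x + h y) * diff_prod h l' else 1
  else 1.

Lemma diff_prod_cons (V : Type) (h : V -> 'F_2) x y l :
  diff_prod h [:: x, y & l] = (h x + h y) * diff_prod h (y :: l).
Proof. by []. Qed.

Lemma diff_prod_shift (V : Type) (h : V -> 'F_2) a l :
  diff_prod (fun x => h x + a) l = diff_prod h l.
Proof.
elim: l => // x [//|y l] IH.
by rewrite !diff_prod_cons IH addrACA addF2 addr0.
Qed.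

Lemma diff_prod_map (V W : Type) (f : V -> W) h l :
  diff_prod h (map f l) = diff_prod (h \o f) l.
Proof. by elim: l => //= x [|y l] //= ->. Qed.

Lemma prism_diff_prod (A : Type) (h : A * bool -> 'F_2) a l :
  (forall a, h (a, true) = 0) ->
  prism (diff_prod h) (a :: l) =
  diff_prod h (level false (a :: l)) * h (last a l, false).
Proof.
move=> h0; elim: l a => [|a' l IH] a.
  by rewrite /= h0 !addr0 mulr1 mul1r.
transitivity ((h (a, false) + h (a', false)) * prism (diff_prod h) (a' :: l)).
  by rewrite /= !h0 !(addr0, mul0r, mulr0, add0r) mulrDr -prismMl.
by rewrite IH mulrA.
Qed.

(** * Geometry of the standard simplex *)

Section Mixture.
Context {R : realType}.
Local Notation simplex := (simplex R).

Lemma simplex_ge0 n (t : simplex n) i : 0 <= set_val t ord0 i.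
Proof. by have [] : simplex n (set_val t) by exact: set_valP. Qed.

Lemma simplex_sum n (t : simplex n) : \sum_i set_val t ord0 i = 1.
Proof. by have [] : simplex n (set_val t) by exact: set_valP. Qed.

Lemma mixture_subproof k n (p : 'I_k.+1 -> simplex n) (t : simplex k) :
  \sum_j set_val t ord0 j *: set_val (p j) \in simplex n.
Proof.
rewrite inE; split=> [i|].
  rewrite summxE sumr_ge0// => j _.
  by rewrite mxE mulr_ge0// simplex_ge0.
under eq_bigr do rewrite summxE.
rewrite exchange_big/= -[RHS](simplex_sum t); apply: eq_bigr => j _.
under eq_bigr do rewrite mxE.
by rewrite -mulr_sumr simplex_sum mulr1.
Qed.

Definition mixture k n (p : 'I_k.+1 -> simplex n) (t : simplex k) : simplex n :=
  SigSub (mixture_subproof p t).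

Lemma mixtureE k n (p : 'I_k.+1 -> simplex n) (t : simplex k) :
  set_val (mixture p t) = \sum_j set_val t ord0 j *: set_val (p j).
Proof. by []. Qed.

Lemma coord_vertex n (i j : 'I_n.+1) :
  set_val (vertex i : simplex n) ord0 j = (j == i)%:R.
Proof. by rewrite mxE eqxx. Qed.

Lemma mixture_vertex k n (p : 'I_k.+1 -> simplex n) i :
  mixture p (vertex i) = p i.
Proof.
apply: val_inj; rewrite -!set_valE mixtureE (bigD1 i)//= coord_vertex eqxx.
rewrite scale1r big1 ?addr0// => j /negbTE ji.
by rewrite coord_vertex ji scale0r.
Qed.

Lemma mixture_comp k m n (p : 'I_m.+1 -> simplex n) (q : 'I_k.+1 -> simplex m) t :
  mixture p (mixture q t) = mixture (fun j => mixture p (q j)) t.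
Proof.
apply: val_inj; rewrite -!set_valE !mixtureE.
under [RHS]eq_bigr do rewrite mixtureE scaler_sumr.
rewrite exchange_big/=; apply: eq_bigr => i _.
rewrite summxE scaler_suml; apply: eq_bigr => j _.
by rewrite mxE scalerA.
Qed.

Lemma simplex_mapE m n (f : 'I_m.+1 -> 'I_n.+1) (t : simplex m) :
  simplex_map f t = mixture (fun i => vertex (f i)) t.
Proof.
apply: val_inj; rewrite -!set_valE mixtureE; apply/rowP => j.
rewrite mxE summxE big_mkcond/=; apply: eq_bigr => i _.
by rewrite mxE coord_vertex eq_sym; case: eqP; rewrite ?mulr1 ?mulr0.
Qed.

Lemma simplex_map_vertex m n (f : 'I_m.+1 -> 'I_n.+1) i :
  simplex_map f (vertex i : simplex m) = vertex (f i).
Proof. by rewrite simplex_mapE mixture_vertex. Qed.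

Lemma simplex_map_comp k m n (f : 'I_m.+1 -> 'I_n.+1) (g : 'I_k.+1 -> 'I_m.+1)
    (t : simplex k) :
  simplex_map f (simplex_map g t) = simplex_map (f \o g) t.
Proof.
rewrite !simplex_mapE mixture_comp; congr mixture; apply/funext => j.
by rewrite mixture_vertex.
Qed.

Lemma mixture_vertices n (t : simplex n) : mixture (fun i => vertex i) t = t.
Proof.
apply: val_inj; rewrite -!set_valE mixtureE; apply/rowP => j.
rewrite summxE (bigD1 j)//= mxE coord_vertex eqxx mulr1 big1 ?addr0// => i ij.
by rewrite mxE coord_vertex eq_sym (negbTE ij) mulr0.
Qed.

Lemma simplex0_eq (t : simplex 0) : t = vertex ord0.
Proof.
apply: val_inj; apply/rowP => j; have := simplex_sum t.
by rewrite big_ord1 -!set_valE coord_vertex !ord1 eqxx.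
Qed.

Definition weight m (b : 'I_m.+1 -> R) (t : simplex m) : R :=
  \sum_j set_val t ord0 j * b j.

Lemma weight_continuous m (b : 'I_m.+1 -> R) : continuous (weight b).
Proof.
apply: continuous_big; first exact: add_continuous.
move=> j _ t; have c : continuous (fun t : simplex m => set_val t ord0 j).
  by apply: continuous_coord; exact: continuous_set_val.
exact: (cvgM (c t) (@cvg_cst _ _ _ _ _)).
Qed.

Lemma weight_vertex m (b : 'I_m.+1 -> R) i : weight b (vertex i) = b i.
Proof.
rewrite /weight (bigD1 i)//= coord_vertex eqxx mul1r big1 ?addr0// => j /negbTE ji.
by rewrite coord_vertex ji mul0r.
Qed.

Lemma weight_simplex_map k m (f : 'I_k.+1 -> 'I_m.+1) b (t : simplex k) :
  weight b (simplex_map f t) = weight (b \o f) t.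
Proof.
rewrite /weight [RHS](partition_big f xpredT)//=; apply: eq_bigr => j _.
by rewrite mxE mulr_suml; apply: eq_bigr => i /eqP <-.
Qed.

Lemma mixture_continuous k n (p : 'I_k.+1 -> simplex n) :
  continuous (mixture p).
Proof.
apply: continuous_set_type.
rewrite (_ : _ \o _ = fun t : simplex k =>
  \sum_j set_val t ord0 j *: set_val (p j)); last by apply/funext.
move=> x; apply: continuous_big; first exact: add_continuous.
move=> j _ y; have c : continuous (fun t : simplex k => set_val t ord0 j).
  by apply: continuous_coord; exact: continuous_set_val.
exact: (cvgZr_tmp (c y)).
Qed.

HB.instance Definition _ k n (p : 'I_k.+1 -> simplex n) :=
  isContinuous.Build (simplex k) (simplex n) (mixture p)
    (@mixture_continuous k n p).

End Mixture.

Section Metric.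
Context {R : realType}.
Local Notation simplex := (simplex R).

Definition dist n (p q : simplex n) : R := `|set_val p - set_val q|.

Lemma dist_ge0 n (p q : simplex n) : 0 <= dist p q.
Proof. exact: normr_ge0. Qed.

Lemma distC n (p q : simplex n) : dist p q = dist q p.
Proof. exact: distrC. Qed.

Lemma dist_trans n (p q r : simplex n) : dist p r <= dist p q + dist q r.
Proof. by rewrite /dist; exact: (ler_distD (set_val q)). Qed.

Lemma distxx n (p : simplex n) : dist p p = 0.
Proof. by rewrite /dist subrr normr0. Qed.

Lemma nbhs_simplexP n (p : simplex n) (A : set (simplex n)) :
  nbhs p A <-> exists2 e : R, 0 < e & forall q, dist p q < e -> A q.
Proof.
split=> [|[e e0 eA]].
  rewrite nbhsE => -[B [[C oC <-] Cp] BA].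
  have /nbhs_ballP[e /= e0 eC] : nbhs (set_val p) C by exact: open_nbhs_nbhs.
  exists e => // q pq; apply: BA; apply: eC.
  by rewrite -ball_normE.
have : nbhs p (set_val @^-1` ball (set_val p) e).
  by apply: (@continuous_set_val _ (simplex n) p); exact: nbhsx_ballx.
by apply: filterS => q /=; rewrite -ball_normE => pq; exact: eA.
Qed.

Lemma dist_mixture k n (x : simplex n) (p : 'I_k.+1 -> simplex n) t r :
  (forall j, dist x (p j) <= r) -> dist x (mixture p t) <= r.
Proof.
move=> pr; rewrite /dist mixtureE.
rewrite -[set_val x]scale1r -(simplex_sum t) scaler_suml -sumrB.
rewrite (le_trans (ler_norm_sum _ _ _))// -[leRHS]mul1r -(simplex_sum t).
rewrite mulr_suml ler_sum// => j _; rewrite -scalerBr normrZ.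
by rewrite ger0_norm ?simplex_ge0// ler_wpM2l ?simplex_ge0//; exact: pr.
Qed.

Lemma dist_le2 n (p q : simplex n) : dist p q <= 2.
Proof.
have le1 (r : simplex n) : `|set_val r| <= 1.
  rewrite /Num.norm/= mx_normrE; apply/bigmax_leP; split=> // -[i j] _ /=.
  rewrite ord1 ger0_norm ?simplex_ge0// -(simplex_sum r).
  by rewrite (bigD1 j)//= lerDl sumr_ge0// => k _; exact: simplex_ge0.
by rewrite (le_trans (ler_normB _ _))// [2]mulr2n lerD.
Qed.

Lemma centre_subproof n : const_mx n.+1%:R^-1 \in simplex n.
Proof.
rewrite inE; split=> [j|]; first by rewrite mxE invr_ge0 ler0n.
under eq_bigr do rewrite mxE.
by rewrite sumr_const card_ord -[LHS]mulr_natl mulfV// pnatr_eq0.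
Qed.

Definition centre n : simplex n := SigSub (centre_subproof n).

Definition bary n (l : seq (simplex n)) : simplex n :=
  mixture (fun j : 'I_(size l).-1.+1 => nth (vertex ord0) l j)
    (centre (size l).-1).

Lemma baryE n k (l : seq (simplex n)) : size l = k.+1 ->
  bary l = mixture (fun j : 'I_k.+1 => nth (vertex ord0) l j) (centre k).
Proof.
by move=> lk; have <- : (size l).-1 = k by rewrite lk.
Qed.

Lemma bary_map n m (p : 'I_m.+1 -> simplex n) (l : seq (simplex m)) :
  l <> [::] -> mixture p (bary l) = bary (map (mixture p) l).
Proof.
move=> l0; have [k lk] : exists k, size l = k.+1.
  by case: (l) l0 => // x l' _; exists (size l').
rewrite (baryE lk) (@baryE _ k) ?size_map// mixture_comp.
congr mixture; apply/funext => j.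
by rewrite (nth_map (vertex ord0))// lk.
Qed.

Lemma dist_bary n (x : simplex n) (l : seq (simplex n)) r : l != [::] ->
  (forall y, y \in l -> dist x y <= r) -> dist x (bary l) <= r.
Proof.
move=> l0 lr; apply: dist_mixture => j; apply: lr.
by rewrite mem_nth// (leq_trans (ltn_ord j))//; case: (l) l0.
Qed.

Lemma dist_bary_mem n N (l : seq (simplex n)) d : (size l <= N.+1)%N ->
  (forall x y, x \in l -> y \in l -> dist x y <= d) ->
  forall x, x \in l -> dist (bary l) x <= N%:R / N.+1%:R * d.
Proof.
move=> lN ld x xl; have [k lk] : exists k, size l = k.+1.
  by case: (l) xl => // z l' _; exists (size l').
have d0 : 0 <= d by rewrite (le_trans _ (ld _ _ xl xl))// dist_ge0.
have il : (index x l < k.+1)%N by rewrite -lk index_mem.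
have kN : k%:R / k.+1%:R * d <= N%:R / N.+1%:R * d.
  rewrite ler_wpM2r// ler_pdivrMr ?ltr0n// mulrAC ler_pdivlMr ?ltr0n//.
  by rewrite -!natrM ler_nat !mulnS [(N * k)%N]mulnC leq_add2r//; move: lN; rewrite lk.
apply: le_trans kN; rewrite (baryE lk) /dist mixtureE.
have -> : set_val x = \sum_j set_val (centre k) ord0 j *: set_val x.
  by rewrite -scaler_suml simplex_sum scale1r.
rewrite -sumrB.
rewrite (le_trans (ler_norm_sum _ _ _))//.
rewrite (bigD1 (Ordinal il))//= nth_index// subrr normr0 add0r.
apply: (@le_trans _ _ (\sum_(i | i != Ordinal il) k.+1%:R^-1 * d)).
  apply: ler_sum => j _; rewrite -scalerBr normrZ mxE ger0_norm ?invr_ge0//.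
  by rewrite ler_wpM2l ?invr_ge0//; apply: ld => //; rewrite mem_nth// lk.
rewrite sumr_const cardC1 card_ord /= -mulrnAl -[X in X * _ <= _]mulr_natl.
by [].
Qed.

End Metric.

(** * Small simplices *)

Section Lebesgue.
Context {R : realType}.
Local Notation simplex := (simplex R).

Lemma simplex_compact n : compact (simplex n).
Proof.
apply: bounded_closed_compact.
  exists 1; split => // M M1 x xS.
  rewrite /Num.norm/= mx_normrE; apply/bigmax_leP; split => [|[i j] _ /=].
    exact: le_trans (ltW M1).
  have [x0 x1] := xS; rewrite ord1 ger0_norm//.
  rewrite (le_trans _ (ltW M1))// -x1 (bigD1 j)//= lerDl sumr_ge0//.
have cc j : continuous (fun x : 'rV[R]_n.+1 => x ord0 j).
  by apply: coord_continuous.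
rewrite (_ : simplex n = \bigcap_i [set t : 'rV[R]_n.+1 | 0 <= t ord0 i] `&`
    [set t | \sum_i t ord0 i = 1]); last first.
  apply/seteqP; split=> [t [t0 t1]|t [t0 t1]]; split=> //.
    by move=> i _; exact: t0.
  by move=> i; exact: (t0 i I).
apply: closedI; first apply: closed_bigI => i _.
  apply: (@preimage_closed _ _ (fun x : 'rV[R]_n.+1 => x ord0 i) [set y | 0 <= y]).
    by move=> x _; exact: cc.
  exact: closed_ge.
apply: (@preimage_closed _ _ (fun t : 'rV[R]_n.+1 => \sum_i t ord0 i) [set 1]).
  move=> x _; move: x; apply: continuous_big; first exact: add_continuous.
  by move=> i _; exact: cc.
exact: closed_eq.
Qed.

Lemma lebesgue_number n I (G : I -> set (simplex n)) :
  (forall p : simplex n, exists i, nbhs p (G i)) ->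
  exists2 e : R, 0 < e &
    forall p : simplex n, exists i, forall q, dist p q <= e -> G i q.
Proof.
move=> cG; have /compact_near_coveringP := @simplex_compact n.
pose P (e : R) (x : 'rV[R]_n.+1) :=
  exists i, forall q : simplex n, `|x - set_val q| <= e -> G i q.
move=> /(_ R (0^'+) P _)[].
  move=> x xS; have [i] := cG (SigSub (mem_set xS)).
  move=> /nbhs_simplexP[e e0 eG].
  exists (ball x (e / 2), [set r : R | r < e / 2]) => /=.
    split; first by apply: nbhsx_ballx; rewrite divr_gt0.
    by apply: nbhs_right_lt; rewrite divr_gt0.
  move=> [y r] [/= xy re]; exists i => q yq; apply: eG.
  rewrite /dist (le_lt_trans (ler_distD y _ _))// [ltRHS]splitr.
  rewrite ltr_leD//; first by move: xy; rewrite -ball_normE.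
  exact: le_trans yq (ltW re).
move=> e /= e0 H; exists (e / 2); first by rewrite divr_gt0.
have /(_ (e / 2)) := H.
have E : ball_ Num.norm 0 e (e / 2).
  by rewrite /ball_/= sub0r normrN ger0_norm ?divr_ge0 ?ltW// ltr_pdivrMr// ltr_pMr// ltr1n.
move=> /(_ E); rewrite divr_gt0// => /(_ isT) Pe p.
have [i iG] := Pe (set_val p) (set_valP p).
by exists i.
Qed.

End Lebesgue.

Section Realization.
Context {R : realType} {Y : topologicalType}.
Local Notation simplex := (simplex R).
Local Notation singular := (singular R Y).

Section Abstract.
Variables (V : Type) (x0 : V) (r : forall m, seq V -> singular m).

(* [r m l] is the singular [m]-simplex spanned by the ordered vertices [l]. *)
Definition realization := forall k m (f : 'I_k.+1 -> 'I_m.+1) l,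
  pullback f (r m l) = r k [seq nth x0 l (f j) | j <- enum 'I_k.+1].

Hypothesis rP : realization.

Lemma size_del i (l : seq V) : (i < size l)%N -> size (del i l) = (size l).-1.
Proof.
move=> il; rewrite size_cat size_take size_drop il.
by rewrite -{2}(subnKC il).
Qed.

Lemma nth_del i (l : seq V) j : (i <= size l)%N ->
  nth x0 (del i l) j = nth x0 l (bump i j).
Proof.
move=> il; rewrite nth_cat size_takel// /bump.
case: ltnP => ji; first by rewrite nth_take.
by rewrite nth_drop; congr nth; rewrite addSn subnKC.
Qed.

Lemma face_realization m (i : 'I_m.+2) l : size l = m.+2 ->
  pullback (lift i) (r m.+1 l) = r m (del i l).
Proof.
move=> lm; rewrite rP; congr r; apply: (@eq_from_nth _ x0).
  by rewrite size_map size_enum_ord size_del ?lm.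
move=> j; rewrite size_map size_enum_ord => jm.
rewrite (nth_map ord0) ?size_enum_ord// nth_del ?lm ?(ltnW (ltn_ord i))//.
by rewrite /= nth_enum_ord.
Qed.

Lemma dl_realization m (c : cochain m) l : size l = m.+2 ->
  dl (fun k => c (r m k)) l = cobound c (r m.+1 l).
Proof.
move=> lm; rewrite dlE lm; apply: eq_bigr => i _.
by rewrite face_realization.
Qed.

End Abstract.

Definition affine_simplex n (s : singular n) m (l : seq (simplex n)) :
    singular m :=
  s \o mixture (fun j : 'I_m.+1 => nth (vertex ord0) l j).

Lemma affine_simplex_realization n (s : singular n) :
  realization (vertex ord0) (affine_simplex s).
Proof.
move=> k m f l; apply/continuousEP => t /=.
rewrite simplex_mapE mixture_comp; congr (s (mixture _ _)); apply/funext => j.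
by rewrite mixture_vertex (nth_map ord0) ?size_enum_ord// nth_ord_enum.
Qed.

Definition vertices n : seq (simplex n) := [seq vertex i | i <- enum 'I_n.+1].

Lemma singular_ext k (s s' : singular k) :
  (forall t, s t = s' t) -> s = s'.
Proof. by move=> ss'; apply/continuousEP. Qed.

Lemma size_vertices n : size (vertices n) = n.+1.
Proof. by rewrite size_map size_enum_ord. Qed.

Lemma nth_vertices n (x : simplex n) (j : 'I_n.+1) :
  nth x (vertices n) j = vertex j.
Proof. by rewrite (nth_map ord0) ?size_enum_ord// nth_ord_enum. Qed.

Lemma affine_simplex_vertices n (s : singular n) :
  affine_simplex s n (vertices n) = s.
Proof.
apply/continuousEP => t /=; congr (s _); rewrite -[RHS]mixture_vertices.
by congr mixture; apply/funext => j; rewrite nth_vertices.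
Qed.

Lemma map_vertices_lift n (i : 'I_n.+2) :
  [seq simplex_map (lift i) v | v <- vertices n] = del i (vertices n.+1).
Proof.
apply: (@eq_from_nth _ (vertex ord0)).
  by rewrite size_map size_del !size_vertices.
move=> j; rewrite size_map size_vertices => jn.
rewrite nth_del ?size_vertices ?(ltnW (ltn_ord i))//.
rewrite (nth_map (vertex ord0)) ?size_vertices//.
by rewrite (nth_vertices _ (Ordinal jn)) simplex_map_vertex
  (nth_vertices _ (lift i (Ordinal jn))).
Qed.

Lemma affine_simplex_map n m (f : 'I_m.+1 -> 'I_n.+1) (s : singular n) k l :
  size l = k.+1 ->
  affine_simplex (pullback f s) k l =
  affine_simplex s k (map (simplex_map f) l).
Proof.
move=> lk; apply/continuousEP => t /=; congr (s _).
rewrite simplex_mapE mixture_comp; congr mixture; apply/funext => j.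
by rewrite (nth_map (vertex ord0)) ?lk// simplex_mapE.
Qed.

End Realization.

Section SmallSimplices.
Context {R : realType} {Y : topologicalType}.
Local Notation simplex := (simplex R).
Local Notation singular := (singular R Y).

(* [rho] is the contraction factor of barycentric subdivision in dimension [N]. *)
Definition rho N : R := N%:R / N.+1%:R.

Lemma Sd_small n N m (g : seq (simplex n) -> 'F_2) (C : pred (simplex n)) d l :
  bclosed (@bary R n) C -> {subset l <= C} ->
  (m <= N.+1)%N -> size l = m ->
  (forall x y, x \in l -> y \in l -> dist x y <= d) ->
  (forall k, size k = m -> {subset k <= C} ->
    (forall x y, x \in k -> y \in k -> dist x y <= rho N * d) -> g k = 0) ->
  Sd (@bary R n) m g l = 0.
Proof.
elim: m g C l => [|m IH] g C l bC lC mN lm ld g0.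
  by case: l lm lC ld => // _ lC ld; exact: g0.
have l0 : l != [::] by case: (l) lm.
have d0 : 0 <= d.
  by case: (l) l0 ld => // x l' _ ld; rewrite -(distxx x) ld ?mem_head.
have blC : bary l \in C by exact: bC.
apply: dl_eq0 => k kl; rewrite lm/= => km.
pose C' : pred (simplex n) :=
  [pred x | (x \in C) && (dist (bary l) x <= rho N * d)].
apply: (IH _ C') => //.
- move=> k' k'0 k'C; rewrite inE bC//=; last by move=> x /k'C /andP[].
  by apply: dist_bary => // y /k'C /andP[].
- move=> x /kl xl; rewrite inE lC//=; apply: dist_bary_mem => //.
  by rewrite lm.
- exact: ltnW.
- by move=> x y /kl xl /kl; exact: ld.
- move=> k' k'm k'C k'd; apply: g0; first by rewrite /= k'm.
    by move=> x; rewrite inE => /orP[/eqP->//|/k'C /andP[]].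
  have rd0 : 0 <= rho N * d by rewrite mulr_ge0// divr_ge0.
  move=> x y; rewrite !inE => /orP[/eqP->|xk] /orP[/eqP->|yk].
  + by rewrite distxx.
  + by have /andP[] := k'C _ yk.
  + by rewrite distC; have /andP[] := k'C _ xk.
  + exact: k'd.
Qed.

Lemma iter_Sd_small n m (g : seq (simplex n) -> 'F_2) d j l :
  size l = m.+1 -> (forall x y, x \in l -> y \in l -> dist x y <= d) ->
  (forall k, size k = m.+1 ->
    (forall x y, x \in k -> y \in k -> dist x y <= rho m ^+ j * d) ->
    g k = 0) ->
  iter j (Sd (@bary R n) m.+1) g l = 0.
Proof.
elim: j d l => [|j IH] d l lm ld g0.
  by apply: g0 => // x y xl yl; rewrite mul1r ld.
rewrite iterS; apply: (@Sd_small _ m _ _ xpredT d) => // k km _ kd.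
by apply: (IH _ _ km kd) => k' k'm k'd; apply: g0 => // x y xk yk;
  rewrite exprSr -mulrA k'd.
Qed.

Lemma rho_cvg m : rho m ^+ j @[j --> \oo] --> (0 : R).
Proof.
apply: cvg_expr; rewrite ger0_norm ?divr_ge0//.
by rewrite ltr_pdivrMr ?ltr0n// mul1r ltr_nat.
Qed.

Lemma dist_affine n m (s : singular n) (l : seq (simplex n)) e p :
  size l = m.+1 -> (forall x y, x \in l -> y \in l -> dist x y <= e) ->
  p \in l -> forall t, exists2 q, affine_simplex s m l t = s q & dist p q <= e.
Proof.
move=> lm le pl t.
exists (mixture (fun j : 'I_m.+1 => nth (vertex ord0) l j) t) => //.
by apply: dist_mixture => j; apply: le => //; rewrite mem_nth// lm.
Qed.

Variables (I : Type) (U : I -> set Y).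
Hypothesis U_open : forall i, open (U i).
Hypothesis U_cover : forall y, exists i, U i y.

Definition is_small n (s : singular n) := exists i, forall t, U i (s t).

Variables (m : nat) (c : cochain (R := R) (Y := Y) m.+1).
Hypothesis c_cocycle : forall s, cobound c s = 0.
Hypothesis c_small : forall s, is_small s -> c s = 0.

Let g n (s : singular n) l := c (affine_simplex s m.+1 l).

Lemma small_scale n (s : singular n) : exists2 e : R, 0 < e &
  forall l, size l = m.+2 -> (forall x y, x \in l -> y \in l -> dist x y <= e) ->
  g s l = 0.
Proof.
have [|e e0 eU] := @lebesgue_number _ n I (fun i => s @^-1` U i).
  move=> p; have [i Ui] := U_cover (s p); exists i.
  by apply: (@cts_fun _ _ s); apply: open_nbhs_nbhs; split.
exists e => // l lm le; have [p pl] : exists p, p \in l.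
  by case: l lm {le} => // p l _; exists p; rewrite mem_head.
apply: c_small; have [i Ui] := eU p; exists i => t.
by have [q -> pq] := dist_affine s lm le pl t; exact: Ui.
Qed.

Definition scale_bound n (s : singular n) (M : nat) := forall j, (M <= j)%N ->
  forall l, size l = m.+2 ->
  (forall x y, x \in l -> y \in l -> dist x y <= rho m.+1 ^+ j * 2) ->
  g s l = 0.

Lemma ex_scale_bound n (s : singular n) : exists M, scale_bound s M.
Proof.
have [e e0 eg] := small_scale s.
have /cvgrPdist_lt/(_ (e / 2)) := @rho_cvg m.+1.
rewrite divr_gt0// => /(_ isT)[M _ MP]; exists M => j Mj l lm le.
apply: eg => // x y xl yl; rewrite (le_trans (le _ _ xl yl))//.
have := MP j Mj; rewrite /= sub0r normrN ger0_norm ?exprn_ge0 ?divr_ge0// => /ltW.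
by rewrite ler_pdivlMr.
Qed.

Let M n (s : singular n) : nat := xget 0%N [set M | scale_bound s M].

Let M_bound n (s : singular n) : scale_bound s (M s).
Proof. by have [k kP] := ex_scale_bound s; exact: (xgetPex 0%N (ex_intro _ k kP)). Qed.

Let h n (s : singular n) j := Td (@bary R n) m.+1 (iter j (Sd (@bary R n) m.+2) (g s)).

Let h_eq0 n (s : singular n) j l : size l = m.+1 -> (M s <= j)%N -> h s j l = 0.
Proof.
move=> lm Mj; apply: (@Td_eq0 _ _ xpredT) => // k _ km.
apply: (@iter_Sd_small _ _ _ 2) => // [x y _ _|]; first exact: dist_le2.
by move=> k' k'm k'd; exact: (@M_bound _ s j).
Qed.

Lemma small_coboundary : is_coboundary c.
Proof.
exists (fun s : singular m => \sum_(j < M s) h s j (vertices m)).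
apply/funext => s.
have sumE k (s' : singular k) K l : size l = m.+1 -> (M s' <= K)%N ->
    \sum_(j < M s') h s' j l = \sum_(j < K) h s' j l.
  move=> lm MK; rewrite -(subnKC MK) big_split_ord/= [X in _ + X]big1 ?addr0//.
  by move=> j _; rewrite h_eq0// leq_addr.
pose K := maxn (M s) (\max_(i < m.+2) M (pullback (lift i) s)).
transitivity (dl (fun k => \sum_(j < K) h s j k) (vertices m.+1)).
  have gc k : size k = m.+3 -> dl (g s) k = 0.
    move=> km.
    by rewrite /g (dl_realization (affine_simplex_realization s))// c_cocycle.
  apply/esym/(etrans (Td_sum_homotopy _ K (size_vertices _) gc)).
  rewrite (@iter_Sd_small _ _ _ 2) ?size_vertices//.
    by rewrite addr0 /g affine_simplex_vertices.
    by move=> x y _ _; exact: dist_le2.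
  by move=> k' k'm k'd; apply: (@M_bound _ s K) => //; rewrite leq_maxl.
rewrite dlE size_vertices; apply: eq_bigr => i _.
rewrite (sumE _ _ K) ?size_vertices//; last first.
  rewrite leq_max; apply/orP; right.
  by rewrite (bigD1 i)//= leq_maxl.
apply: eq_bigr => j _.
have bmap l : l <> [::] -> simplex_map (lift i) (bary l) =
    bary (map (simplex_map (lift i)) l) :> simplex m.+1.
  move=> l0; rewrite simplex_mapE bary_map//.
  by congr bary; apply: eq_map => x; rewrite simplex_mapE.
rewrite -map_vertices_lift /h -(Td_map bmap) ?size_vertices//.
apply: eq_Td; rewrite ?size_vertices// => k km.
rewrite -(iter_Sd_map bmap)//.
elim: (nat_of_ord j) k km => [|a IH] k km.
  by rewrite /= /g affine_simplex_map.
by rewrite !iterS; apply: eq_Sd.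
Qed.

End SmallSimplices.

(** * Cup products *)

Section CupProducts.
Context {R : realType} {Y : topologicalType}.
Local Notation singular := (singular R Y).
Local Notation cochain := (@cochain R Y).

Lemma is_coboundary0 n : is_coboundary (0 : cochain n).
Proof. by case: n => [//|n]; exists 0; rewrite raddf0. Qed.

Lemma is_coboundaryD n (a b : cochain n) :
  is_coboundary a -> is_coboundary b -> is_coboundary (a + b).
Proof.
case: n a b => [|n] a b /=; first by move=> -> ->; rewrite addr0.
by move=> [a' ->] [b' ->]; exists (a' + b'); rewrite raddfD.
Qed.

Lemma addcc n (a : cochain n) : a + a = 0.
Proof. by apply/funext => s; exact: addF2. Qed.

Lemma oppc n (a : cochain n) : - a = a.
Proof. by apply/funext => s; exact: oppF2. Qed.

Definition cohomologous n (a b : cochain n) := is_coboundary (a + b).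

Lemma cohomologous_refl n (a : cochain n) : cohomologous a a.
Proof. by rewrite /cohomologous addcc; exact: is_coboundary0. Qed.

Lemma cohomologous_sym n (a b : cochain n) :
  cohomologous a b -> cohomologous b a.
Proof. by rewrite /cohomologous addrC. Qed.

Lemma cohomologous_trans n (b a c : cochain n) :
  cohomologous a b -> cohomologous b c -> cohomologous a c.
Proof.
move=> ab bc; have := is_coboundaryD ab bc.
by rewrite /cohomologous addrA -[a + b + b]addrA addcc addr0.
Qed.

Lemma cohomologous_coboundary n (a b : cochain n) :
  cohomologous a b -> is_coboundary b -> is_coboundary a.
Proof.
by move=> ab cb; have := is_coboundaryD ab cb; rewrite -addrA addcc addr0.
Qed.

Section Lists.
Variables (V : Type) (x0 : V) (r : forall m, seq V -> singular m).
Hypothesis rP : realization x0 r.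

Lemma cup0_realization m (g : cochain 0) (d : cochain m) x l : size l = m ->
  @cup R Y 0 m g d (r m (x :: l)) = g (r 0 [:: x]) * d (r m (x :: l)).
Proof.
move=> lm; rewrite /cup !rP; congr (g (r _ _) * d (r _ _)).
  by rewrite enum_ordSl enum_ord0 /= /front inordK.
apply: (@eq_from_nth _ x0); rewrite size_map size_enum_ord/= ?lm// => i im.
rewrite (nth_map ord0) ?size_enum_ord// /back nth_enum_ord// add0n.
by rewrite inordK.
Qed.

Lemma cup1_realization m (c : cochain 1) (d : cochain m) x y l : size l = m ->
  @cup R Y 1 m c d (r m.+1 (x :: y :: l)) =
  c (r 1 [:: x; y]) * d (r m (y :: l)).
Proof.
move=> lm; rewrite /cup !rP; congr (c (r _ _) * d (r _ _)).
  by rewrite enum_ordSl enum_ordSl enum_ord0 /= /front !inordK.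
apply: (@eq_from_nth _ x0); rewrite size_map size_enum_ord/= ?lm// => i im.
rewrite (nth_map ord0) ?size_enum_ord// /back nth_enum_ord// add1n.
by rewrite inordK.
Qed.

End Lists.

Lemma vertices_cons n : exists (x : simplex R n) l,
  size l = n /\ vertices n = x :: l.
Proof.
have := @size_vertices R n; case: (vertices n) => // x l [ln].
by exists x, l.
Qed.

Lemma cobound_cup1 m (c : cochain 1) (b : cochain m) : cobound c = 0 ->
  cobound (@cup R Y 1 m c b) = @cup R Y 1 m.+1 c (cobound b).
Proof.
move=> c0; apply/funext => s.
have rP := affine_simplex_realization s.
rewrite -[s]affine_simplex_vertices.
have [x [l1 [+ ->]]] := vertices_cons m.+2.
case: l1 => // y; case=> // z l [lm].
have sz : size [:: x, y, z & l] = m.+3 by rewrite /= lm.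
have sz' : size [:: y, z & l] = m.+2 by rewrite /= lm.
rewrite (cup1_realization rP); last by rewrite /= lm.
rewrite -(dl_realization rP _ sz) -(dl_realization rP _ sz').
rewrite (dl_cons2 _ x y (z :: l)) (dl_cons _ y (z :: l)).
pose cc u v := c (affine_simplex s 1 [:: u; v]).
have cxyz : cc y z + (cc x z + cc x y) = 0.
  have := congr1 (@^~ (affine_simplex s 2 [:: x; y; z])) c0.
  by rewrite -(dl_realization rP)//= addr0.
rewrite !(cup1_realization rP)//.
transitivity (cc y z * b (affine_simplex s m (z :: l)) +
  (cc x z * b (affine_simplex s m (z :: l)) +
   cc x y * dl (fun k => b (affine_simplex s m (y :: k))) (z :: l))).
  congr (_ + (_ + _)); rewrite -dlMl; apply: (@eq_dl _ _ _ (z :: l)) => k /= kl.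
  by rewrite (cup1_realization rP) ?kl.
move: cxyz => /addF2_eq0 ->.
by rewrite addrA -mulrDl -addrA [cc x y + _]addrC addrA addF2 add0r -mulrDr.
Qed.

Lemma cobound_cup0 m (g : cochain 0) (d : cochain m) : cobound d = 0 ->
  cobound (@cup R Y 0 m g d) = @cup R Y 1 m (cobound g) d.
Proof.
move=> d0; apply/funext => s.
have rP := affine_simplex_realization s.
rewrite -[s]affine_simplex_vertices.
have [x [l1 [+ ->]]] := vertices_cons m.+1.
case: l1 => // y l [lm].
have sz : size [:: x, y & l] = m.+2 by rewrite /= lm.
rewrite (cup1_realization rP)//.
rewrite -(dl_realization rP _ sz) -(dl_realization rP)//.
have : dl (fun k => d (affine_simplex s m k)) [:: x, y & l] = 0.
  by rewrite (dl_realization rP)// d0.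
rewrite !(dl_cons _ x (y :: l)) => /addF2_eq0 dy.
rewrite (cup0_realization rP)//.
transitivity (g (affine_simplex s 0 [:: y]) * d (affine_simplex s m (y :: l)) +
  g (affine_simplex s 0 [:: x]) *
  dl (fun k => d (affine_simplex s m (x :: k))) (y :: l)).
  congr (_ + _); rewrite -dlMl; apply: (@eq_dl _ _ _ (y :: l)) => k /= kl.
  by rewrite (cup0_realization rP) ?kl.
by rewrite -dy -mulrDl /= addr0.
Qed.

Lemma cup0r p q (c : cochain p) : @cup R Y p q c 0 = 0.
Proof. by apply/funext => s; rewrite /cup mulr0. Qed.

Lemma cupDr p q (c : cochain p) (d d' : cochain q) :
  cup c (d + d') = cup c d + cup c d'.
Proof. by apply/funext => s; rewrite /cup mulrDr. Qed.

Lemma cupDl p q (c c' : cochain p) (d : cochain q) :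
  cup (c + c') d = cup c d + cup c' d.
Proof. by apply/funext => s; rewrite /cup mulrDl. Qed.

Lemma cup1_coboundary m (c : cochain 1) (d : cochain m) :
  cobound c = 0 -> is_coboundary d ->
  @is_coboundary R Y m.+1 (@cup R Y 1 m c d).
Proof.
move=> c0; case: m d => [|m] d /=; first by move=> ->; exists 0; rewrite cup0r raddf0.
by move=> [b ->]; exists (@cup R Y 1 m c b); rewrite cobound_cup1.
Qed.

Lemma cup1_cohomologous m (c c' : cochain 1) (d d' : cochain m) :
  cobound c' = 0 -> cobound d = 0 -> cohomologous c c' -> cohomologous d d' ->
  @cohomologous m.+1 (@cup R Y 1 m c d) (@cup R Y 1 m c' d').
Proof.
move=> c'0 d0 [g cc'] dd'.
apply: (@cohomologous_trans _ (@cup R Y 1 m c' d)).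
  rewrite /cohomologous -(@cupDl 1 m) cc' -cobound_cup0//.
  by exists (@cup R Y 0 m g d).
by rewrite /cohomologous -(@cupDr 1 m); exact: cup1_coboundary.
Qed.

Fixpoint cup_prod m (c : nat -> cochain 1) : cochain m :=
  match m return cochain m with
  | 0 => fun _ => 1
  | m'.+1 => @cup R Y 1 m' (c 0%N) (@cup_prod m' (c \o S))
  end.
Arguments cup_prod m c : clear implicits.

Lemma cobound_cup_prod m (c : nat -> cochain 1) :
  (forall i, cobound (c i) = 0) -> cobound (cup_prod m c) = 0.
Proof.
elim: m c => [|m IH] c c0 /=; last first.
  by rewrite cobound_cup1// IH// ?cup0r// => i; exact: c0.
have /eqP // := @unit_cocycle_subproof R Y.
Qed.

Lemma cup_prod_cohomologous m (c c' : nat -> cochain 1) :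
  (forall i, cobound (c i) = 0) -> (forall i, cobound (c' i) = 0) ->
  (forall i, cohomologous (c i) (c' i)) ->
  cohomologous (cup_prod m c) (cup_prod m c').
Proof.
elim: m c c' => [|m IH] c c' c0 c'0 cc'; first exact: cohomologous_refl.
apply: cup1_cohomologous => //; first by apply: cobound_cup_prod => i /=.
apply: (IH (c \o S) (c' \o S)) => i; [exact: c0|exact: c'0|exact: cc'].
Qed.

Lemma cup_prod_tail n k (c : nat -> cochain 1) :
  (forall i, cobound (c i) = 0) ->
  is_coboundary (cup_prod k (fun i => c (n + i)%N)) ->
  is_coboundary (cup_prod (n + k) c).
Proof.
elim: n c => [//|n IH] c c0 cb.
by apply: cup1_coboundary => //; apply: IH => // i; exact: c0.
Qed.

Lemma cup_prod_eq0 m (c : nat -> cochain 1) (s : singular m) i : (i < m)%N ->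
  (forall f : 'I_2 -> 'I_m.+1, c i (pullback f s) = 0) -> cup_prod m c s = 0.
Proof.
elim: m c s i => // m IH c s [_|i im] ci /=; rewrite /cup.
  by rewrite ci mul0r.
rewrite (IH _ _ i) ?mulr0// => f /=.
by rewrite pullback_comp ci.
Qed.

Lemma cup_prodD m (c c' c'' : nat -> cochain 1) j : (j < m)%N ->
  (forall i, i != j -> c i = c' i /\ c'' i = c' i) -> c j + c' j = c'' j ->
  cup_prod m c + cup_prod m c' = cup_prod m c''.
Proof.
elim: m c c' c'' j => // m IH c c' c'' [_|j jm] ci cj.
  rewrite /= -(_ : c \o S = c' \o S); last first.
    by apply/funext => i; have [] := ci i.+1 isT.
  rewrite -(_ : c \o S = c'' \o S); last first.
    by apply/funext => i /=; have [-> ->] := ci i.+1 isT.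
  by rewrite -(@cupDl 1 m) cj.
have [c0 c''0] := ci 0%N isT.
rewrite /= c0 c''0 -(@cupDr 1 m) (IH _ _ (c'' \o S) j)// => i ij.
exact: ci.
Qed.

Section Lists.
Variables (V : Type) (x0 : V) (r : forall m, seq V -> singular m).
Hypothesis rP : realization x0 r.

Lemma cup_prod_realization m (c : cochain 1) (h : V -> 'F_2) l :
  (forall x y, c (r 1 [:: x; y]) = h x + h y) -> size l = m.+1 ->
  cup_prod m (fun=> c) (r m l) = diff_prod h l.
Proof.
move=> ch; elim: m l => [|m IH] [|x [|y l]]// [lm].
rewrite [LHS](cup1_realization rP)// ch.
by congr (_ * _); apply: IH; rewrite /= lm.
Qed.

End Lists.

Lemma cohomology_eq0 n (z : cocycle (R := R) (Y := Y) n) :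
  (\pi_(cohomology R Y n) z == 0) = `[< is_coboundary (val z) >].
Proof.
by rewrite -[X in _ == X](raddf0 \pi_(cohomology R Y n)) -Quotient.idealrBE subr0.
Qed.

Lemma cohomology_exp_cup_prod (w : cohomology R Y 1) m :
  cohomologous (val (repr (cohomology_exp w m)))
    (cup_prod m (fun=> val (repr w))).
Proof.
have pi_coh n (z : cocycle (R := R) (Y := Y) n) :
    cohomologous (val (repr (\pi_(cohomology R Y n) z))) (val z).
  have : repr (\pi_(cohomology R Y n) z) - z \in @coboundary R Y n.
    by rewrite Quotient.idealrBE reprK.
  by rewrite unfold_in => /asboolP /=; rewrite oppc.
have cocycle0 n (z : cocycle (R := R) (Y := Y) n) : cobound (val z) = 0.
  exact/eqP/(cocycleP z).
elim: m => [|m IH] /=.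
  exact: (pi_coh 0%N (Cocycle (@unit_cocycle_subproof R Y))).
apply: (cohomologous_trans (pi_coh m.+1 (cup_cocycle (repr w)
  (repr (cohomology_exp w m))))).
by apply: cup1_cohomologous (cocycle0 _ _) (cocycle0 _ _)
  (cohomologous_refl _) IH.
Qed.

Lemma cohomology_exp_eq0 (w : cohomology R Y 1) m (c : nat -> cochain 1) :
  (forall i, cobound (c i) = 0) ->
  (forall i, cohomologous (val (repr w)) (c i)) ->
  cohomology_exp w m = 0 <-> is_coboundary (cup_prod m c).
Proof.
move=> c0 wc.
have wmc : cohomologous (val (repr (cohomology_exp w m))) (cup_prod m c).
  apply: cohomologous_trans (cohomology_exp_cup_prod w m) _.
  apply: cup_prod_cohomologous => // i.
  exact/eqP/(cocycleP (repr w)).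
have -> : cohomology_exp w m = 0 <->
    is_coboundary (val (repr (cohomology_exp w m))).
  rewrite -{1}[cohomology_exp w m]reprK; split=> [/eqP|cb].
    by rewrite cohomology_eq0 => /asboolP.
  by apply/eqP; rewrite cohomology_eq0; exact/asboolP.
split; first by apply: cohomologous_coboundary; exact: cohomologous_sym.
exact: cohomologous_coboundary.
Qed.

End CupProducts.
Arguments cup_prod {R Y} m c.

(** * Lifting simplices to a double cover *)

Section Steps.
Context {R : realType}.
Local Notation simplex := (simplex R).

Lemma segment_subproof N i : (i <= N)%N ->
  \row_(j < 2) (if j == ord0 then (1 - i%:R / N%:R : R) else i%:R / N%:R)
  \in simplex 1.
Proof.
move=> iN; have ge0 : 0 <= i%:R / N%:R :> R by rewrite divr_ge0.
rewrite inE; split=> [j|]; last first.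
  by rewrite big_ord_recl big_ord1 !mxE/= subrK.
rewrite mxE; case: ifP => // _; rewrite subr_ge0.
case: N iN {ge0} => [|N] iN; first by rewrite invr0 mulr0.
by rewrite ler_pdivrMr ?ltr0n// mul1r ler_nat.
Qed.

Definition step N i n (p q : simplex n) : simplex n :=
  mixture (fun j : 'I_2 => if j == ord0 then p else q)
    (insubd (vertex ord0)
      (\row_(j < 2) (if j == ord0 then (1 - i%:R / N%:R : R) else i%:R / N%:R))).

Lemma val_step N i n (p q : simplex n) : (i <= N)%N ->
  set_val (step N i p q) =
  (1 - i%:R / N%:R) *: set_val p + (i%:R / N%:R) *: set_val q.
Proof.
move=> iN; rewrite mixtureE big_ord_recl big_ord1 /= !set_valE insubdK.
  by rewrite !mxE.
exact: segment_subproof.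
Qed.

Lemma step0 N n (p q : simplex n) : step N 0 p q = p.
Proof.
by apply: val_inj; rewrite -!set_valE val_step// mul0r subr0 scale0r scale1r addr0.
Qed.

Lemma step_last N n (p q : simplex n) : step N.+1 N.+1 p q = q.
Proof.
apply: val_inj; rewrite -!set_valE val_step// divff ?pnatr_eq0//.
by rewrite subrr scale0r scale1r add0r.
Qed.

Lemma dist_step_next N i n (p q : simplex n) : (i < N)%N ->
  dist (step N i p q) (step N i.+1 p q) <= 2 / N%:R.
Proof.
move=> iN; rewrite /dist !val_step//; last exact: ltnW.
have -> : forall a b : R, forall v w : 'rV[R]_n.+1,
    (1 - a) *: v + a *: w - ((1 - b) *: v + b *: w) = (b - a) *: (v - w).
  by move=> a b v w; apply/rowP => j; rewrite !mxE; ring.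
rewrite normrZ -mulrBl -natr1 addrAC subrr add0r mul1r.
by rewrite ger0_norm ?invr_ge0// mulrC ler_wpM2r ?invr_ge0//; exact: dist_le2.
Qed.

Lemma dist_step N i n (p q q' : simplex n) : (i <= N)%N ->
  dist (step N i p q) (step N i p q') <= dist q q'.
Proof.
move=> iN; rewrite /dist !val_step// opprD addrACA subrr add0r -scalerBr normrZ.
rewrite ger0_norm ?divr_ge0// ler_piMl//.
case: N iN => [|N] iN; first by rewrite invr0 mulr0.
by rewrite ler_pdivrMr ?ltr0n// mul1r ler_nat.
Qed.

Lemma ex_step_size (e : R) : 0 < e -> exists N, 2 / N.+1%:R <= e.
Proof.
move=> e0; have [N _ Ne] := near_infty_natSinv_lt (PosNum (divr_gt0 e0 (ltr0n R 2))).
by exists N; rewrite mulrC -ler_pdivlMr// ltW//; apply: Ne => /=.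
Qed.

Lemma locally_constant n (P : set (simplex n)) :
  (forall p : simplex n, nbhs p P \/ nbhs p (~` P)) -> forall p q, P p -> P q.
Proof.
move=> Ploc p q Pp.
have [|e e0 eP] := @lebesgue_number R n bool (fun b => if b then P else ~` P).
  by move=> r; case: (Ploc r); [exists true|exists false].
have [N Ne] := ex_step_size e0.
suff H i : (i <= N.+1)%N -> P (step N.+1 i p q) 
  by rewrite -(step_last N p q); exact: H.
elim: i => [|i IH] iN; first by rewrite step0.
have [b bP] := eP (step N.+1 i p q).
have := bP _ (le_trans (dist_step_next p q iN) Ne).
have := bP (step N.+1 i p q); rewrite distxx => /(_ (ltW e0)).
by case: b {bP} => // nP; have := nP (IH (ltnW iN)).
Qed.

Lemma locally_constant_in n (C : set (simplex n)) (P : set (simplex n)) :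
  (forall k (p : 'I_k.+1 -> simplex n) t, (forall j, C (p j)) -> C (mixture p t)) ->
  (forall p : simplex n, C p -> nbhs p P \/ nbhs p (~` P)) ->
  forall p q, C p -> C q -> P p -> P q.
Proof.
move=> Cc Ploc p q Cp Cq.
pose c := mixture (fun j : 'I_2 => if j == ord0 then p else q).
have Cj t : C (c t) by apply: Cc => j; case: ifP.
have := @locally_constant 1 (fun t => P (c t)) _ (vertex ord0) (vertex ord_max).
rewrite /c !mixture_vertex/=; apply => t.
have ct := @mixture_continuous R _ _ (fun j : 'I_2 => if j == ord0 then p else q) t.
by case: (Ploc _ (Cj t)) => H; [left|right]; exact: (ct _ H).
Qed.

End Steps.

Section Lifting.
Context {R : realType} {X : freeZ2Space}.
Local Notation simplex := (simplex R).
Local Notation tau := (@z2_act X).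
Local Notation Xbar := (orbit_space X).
Local Notation pi := (\pi_Xbar : X -> Xbar).
Implicit Types (U V : set X) (x y : X).

Lemma pi_orbitP x y : pi x = pi y <-> y = x \/ y = tau x.
Proof.
split=> [/eqmodP/orP[]/eqP ->|[]->]; [by left|by right|by []|].
by apply/eqmodP; rewrite /= /orbit_rel eqxx orbT.
Qed.

Lemma pi_act x : pi (tau x) = pi x.
Proof. by apply/esym/pi_orbitP; right. Qed.

Lemma pi_surj (y : Xbar) : pi (repr y) = y.
Proof. exact: reprK. Qed.

Lemma pi_open U : open U -> open (pi @` U).
Proof.
move=> oU; rewrite /open/= /quotient_open.
rewrite (_ : _ @^-1` _ = U `|` tau @^-1` U).
  by apply: openU => //; move/continuousP: (@z2_act_continuous X); apply.
apply/seteqP; split=> x /=.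
  by case=> y Uy /pi_orbitP[->|->]; [left|right; rewrite /= z2_actK].
by case=> Ux; [exists x|exists (tau x) => //; rewrite pi_act].
Qed.

Definition sheet U := open U /\ forall x, U x -> ~ U (tau x).

Lemma ex_sheet x : exists2 U, sheet U & U x.
Proof.
have [V Vx VV] := z2_act_free x.
exists V°; last exact: Vx.
split=> [|y Vy Vty]; first exact: open_interior.
suff : (tau @` V `&` V) (tau y) by rewrite VV.
by split; [exists y => //; exact: interior_subset|exact: interior_subset].
Qed.

Lemma sheet_act U : sheet U -> sheet (tau @^-1` U).
Proof.
move=> [oU UU]; split=> [|x /= Utx].
  by move/continuousP: (@z2_act_continuous X); apply.
by rewrite z2_actK => Ux; exact: UU Ux Utx.
Qed.

Lemma sheet_inj U x y : sheet U -> U x -> U y -> pi x = pi y -> x = y.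
Proof. by move=> [_ UU] Ux Uy /pi_orbitP[//|yx]; rewrite yx in Uy; have := UU _ Ux. Qed.

Definition ind U x : 'F_2 := if `[< U x >] then 1 else 0.

Definition covers U (y : Xbar) := (pi @` U) y.

Lemma coversP U x : covers U (pi x) <-> U x \/ U (tau x).
Proof.
split=> [[y Uy /pi_orbitP[->|->]]|]; first by left.
  by right; rewrite z2_actK.
by case=> Ux; [exists x|exists (tau x) => //; exact: pi_act].
Qed.

Lemma ind_act U x : sheet U -> covers U (pi x) -> ind U (tau x) = ind U x + 1.
Proof.
move=> [_ UU] /coversP; rewrite /ind.
case: (asboolP (U x)) => Ux; case: (asboolP (U (tau x))) => Utx.
- by have := UU _ Ux.
- by move=> _; rewrite addF2.
- by rewrite add0r.
- by case.
Qed.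

Lemma ind_eq U V x y : sheet U -> sheet V -> covers U (pi x) -> covers V (pi x) ->
  pi x = pi y -> ind U x + ind V x = ind U y + ind V y.
Proof.
move=> sU sV Ux Vx /pi_orbitP[->//|->].
by rewrite !ind_act// addrACA addF2 addr0.
Qed.

Section SimplexLift.
Variables (n : nat) (f : singular R Xbar n).
Local Notation g p := (repr (f p)).

Lemma ind_locally_constant U V p : sheet U -> sheet V ->
  covers U (f p) -> covers V (f p) ->
  exists2 W, nbhs p W & forall q, W q -> ind U (g q) + ind V (g q) =
    ind U (g p) + ind V (g p).
Proof.
move=> sU sV Up Vp; have [[x Ux xp] [y Vy yp]] := (Up, Vp).
suff [O [oO Ox [c cO]]] : exists O, [/\ open O, O x & exists c, forall w,
    O w -> [/\ U w, covers V (pi w) & ind U w + ind V w = c]].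
  have indO w q : O w -> pi w = f q -> ind U (g q) + ind V (g q) = c.
    move=> /cO[Uw Vw <-] wq; apply/esym/ind_eq => //.
      by apply/coversP; left.
    by rewrite pi_surj.
  exists (f @^-1` (pi @` O)).
    apply: (@cts_fun _ _ f); rewrite -xp.
    by apply: open_nbhs_nbhs; split; [exact: pi_open|exists x].
  by move=> q [w Ow wq]; rewrite (indO _ _ Ow wq) (indO _ _ Ox xp).
have /pi_orbitP[yx|yx] : pi x = pi y by rewrite xp yp.
  exists (U `&` V); split; first by apply: openI; [case: sU|case: sV].
    by split => //; rewrite -yx.
  exists 0 => w [Uw Vw]; split => //; first by apply/coversP; left.
  by rewrite /ind !asboolT// addF2.
have [oV VV] := sheet_act sV.
exists (U `&` (tau @^-1` V)); split; first by apply: openI; [case: sU|].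
  by split => //; rewrite /= -yx.
exists 1 => w [Uw Vw]; split => //; first by apply/coversP; right.
rewrite /ind asboolT// asboolF ?addr0// => Vw'.
by case: sV => _ /(_ _ Vw').
Qed.

(* Two sheets over the same convex set agree or disagree globally on it; the
   sheets are compared along rays from a vertex in [N.+1] steps, each shorter
   than a Lebesgue number of the cover by sheets. *)
Lemma ex_lift : exists l : singular R X n, forall t, pi (l t) = f t.
Proof.
have [|e e0 eU] := @lebesgue_number R n {U | sheet U}
    (fun S => f @^-1` (pi @` sval S)).
  move=> p; have [U sU Up] := ex_sheet (g p).
  exists (exist _ U sU) => /=; apply: (@cts_fun _ _ f); rewrite -[f p]pi_surj.
  apply: open_nbhs_nbhs; split; first by apply: pi_open; case: sU.
  by exists (g p).
pose U p := sval (sval (cid (eU p))).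
have sU p : sheet (U p) by exact: svalP.
have cU p q : dist p q <= e -> covers (U p) (f q).
  exact: (svalP (cid (eU p)) q).
pose chi p q : 'F_2 := ind (U p) (g q).
have e2e (p q : simplex n) : dist p q <= e / 2 -> dist p q <= e.
  by move/le_trans; apply; rewrite ler_pdivrMr// ler_pMr// ler1n.
have indep a b p q : dist a b <= e / 2 -> dist a p <= e / 2 ->
    dist a q <= e / 2 -> chi a p + chi b p = chi a q + chi b q.
  move=> ab ap aq.
  apply: (@locally_constant_in _ _ [set r | dist a r <= e / 2]
    [set r | chi a p + chi b p = chi a r + chi b r] _ _ p q) => //.
    by move=> k s t; exact: dist_mixture.
  move=> r /= ar.
  have br : dist b r <= e.
    by rewrite (le_trans (dist_trans _ a _))// [leRHS]splitr lerD// distC.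
  have [W rW WE] := ind_locally_constant (sU a) (sU b) (cU _ _ (e2e _ _ ar))
    (cU _ _ br).
  case: (eqVneq (chi a p + chi b p) (chi a r + chi b r)) => [E|/eqP E].
    by left; apply: filterS rW => t /WE H /=; rewrite E /chi H.
  by right; apply: filterS rW => t /WE H /= E'; apply: E; rewrite E' /chi H.
pose u p q : 'F_2 := chi p p + chi p q.
have uE a p q : dist a p <= e / 2 -> dist a q <= e / 2 ->
    u p q = chi a p + chi a q.
  move=> ap aq; have := indep a p p q ap ap aq; rewrite /u.
  move: (chi a p) (chi a q) (chi p p) (chi p q) => x y z t.
  by move=> H; apply: addF2_eq0; rewrite addrACA [z + x]addrC [t + y]addrC H addF2.
have e40 : 0 < e / 4 by rewrite divr_gt0.
have [N Ne] := ex_step_size e40.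
pose x i (p : simplex n) := step N.+1 i (vertex ord0) p.
pose v (p : simplex n) : 'F_2 := \sum_(i < N.+1) u (x i p) (x i.+1 p).
have vE (p q : simplex n) : dist p q <= e / 4 -> v p + v q = u p q.
  move=> pq; have e42 : e / 4 + e / 4 = e / 2 by field.
  have e442 : e / 4 <= e / 2 by rewrite -e42 lerDl ltW.
  have xy i : (i <= N.+1)%N -> dist (x i p) (x i q) <= e / 4.
    by move=> iN; exact: le_trans (dist_step _ _ _ iN) pq.
  have xx i r : (i < N.+1)%N -> dist (x i r) (x i.+1 r) <= e / 4.
    by move=> iN; exact: le_trans (dist_step_next _ _ iN) Ne.
  have D i : (i < N.+1)%N -> u (x i p) (x i.+1 p) + u (x i q) (x i.+1 q) =
      u (x i p) (x i q) + u (x i.+1 p) (x i.+1 q).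
    move=> iN; have xy' : dist (x i p) (x i.+1 q) <= e / 2.
      by rewrite (le_trans (dist_trans _ (x i q) _))// -e42 lerD ?xy ?xx// ltnW.
    have xy2 := le_trans (xy _ (ltnW iN)) e442.
    have xx2 := le_trans (xx _ p iN) e442.
    rewrite !(uE (x i p)) ?distxx ?divr_ge0 ?(ltW e0)//; exact: addrACA.
  transitivity (\sum_(i < N.+1)
      (u (x i p) (x i.+1 p) + u (x i q) (x i.+1 q))).
    by rewrite big_split.
  suff H m : (m <= N.+1)%N ->
      \sum_(i < m) (u (x i p) (x i.+1 p) + u (x i q) (x i.+1 q)) =
      u (x 0%N p) (x 0%N q) + u (x m p) (x m q).
    by rewrite H// /x !step0 !step_last {1}/u addF2 add0r.
  elim: m => [|m IH] mN; first by rewrite big_ord0 addF2.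
  rewrite big_ord_recr/= IH; last exact: ltnW.
  by rewrite D// addrA -[_ + _ + u (x m p) _]addrA addF2 addr0.
pose l p : X := if v p == 0 then g p else tau (g p).
have lE p : pi (l p) = f p by rewrite /l; case: ifP; rewrite ?pi_act pi_surj.
have indl V p : sheet V -> covers V (f p) -> ind V (l p) = v p + ind V (g p).
  move=> sV Vp; rewrite /l; case: ifP => [/eqP ->|v0]; first by rewrite add0r.
  rewrite ind_act// ?pi_surj// addrC.
  by case: (F2P (v p)) v0 => ->.
have lc : continuous l.
  move=> p A /=; rewrite nbhsE => -[B [oB Bp] BA].
  have [V sV Vp] := ex_sheet (l p).
  have oBV : open (B `&` V) by apply: openI => //; case: sV.
  apply/nbhs_simplexP.
  have cVp : covers V (f p) by exists (l p); rewrite ?lE.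
  have pp : dist p p <= e by rewrite distxx ltW.
  have [W Wp WE] := ind_locally_constant sV (sU p) cVp (cU p p pp).
  have : nbhs p ((f @^-1` (pi @` (B `&` V))) `&` W).
    apply: filterI => //; apply: (@cts_fun _ _ f); rewrite -lE; apply: open_nbhs_nbhs.
    by split; [exact: pi_open|exists (l p)].
  move=> /nbhs_simplexP[d d0 dV].
  exists (Num.min d (e / 4)) => [|q]; first by rewrite lt_min d0.
  rewrite lt_min => /andP[pd pe]; apply: BA.
  have [[w [Bw Vw] wq] /WE VU] := dV _ pd.
  suff -> : l q = w by [].
  apply: (sheet_inj sV) => //; last by rewrite wq lE.
  have cVq : covers V (f q) by exists w.
  apply: contrapT => nVq; have : ind V (l q) + ind V (l p) = 0.
    rewrite !indl// addrACA [v q + _]addrC vE ?ltW// /u /chi.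
    have -> : ind V (g q) = ind V (g p) + ind (U p) (g p) + ind (U p) (g q).
      by rewrite -VU -addrA addF2 addr0.
    move: (ind V _) (ind _ _) (ind _ _) => a b c.
    by case: (F2P a) (F2P b) (F2P c) => -> [] -> [] ->; apply/val_inj.
  by rewrite {1}/ind asboolF// /ind asboolT// add0r.
exists (mkcts lc); exact: lE.
Qed.

End SimplexLift.

End Lifting.

(** * Paths *)

Lemma continuous_paste (R : realType) (T Y : topologicalType) (h : T -> R)
    (f g : T -> Y) :
  continuous h -> continuous f -> continuous g ->
  (forall t, h t = 0 -> f t = g t) ->
  continuous (fun t => if h t <= 0 then f t else g t).
Proof.
move=> ch cf cg fg t A /= At.
change (nbhs t ((fun t => if h t <= 0 then f t else g t) @^-1` A)).
have fA : nbhs (f t) A -> nbhs t (f @^-1` A) by exact: cf.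
have gA : nbhs (g t) A -> nbhs t (g @^-1` A) by exact: cg.
have hA B : nbhs (h t) B -> nbhs t (h @^-1` B) by exact: ch.
case: (ltgtP (h t) 0) At => [ht /fA At|ht /gA At|ht At].
- have /hA ltH : nbhs (h t) [set x | x < 0].
    by apply: open_nbhs_nbhs; split => //; exact: open_lt.
  by apply: filterS (filterI ltH At) => u [/= /ltW ->].
- have /hA gtH : nbhs (h t) [set x | 0 < x].
    by apply: open_nbhs_nbhs; split => //; exact: open_gt.
  by apply: filterS (filterI gtH At) => u [/= hu]; rewrite leNgt hu.
- have /gA At' : nbhs (g t) A by rewrite -fg.
  by apply: filterS (filterI (fA At) At') => u [/= Au Au']; case: ifP.
Qed.

Section Paths.
Context {R : realType} {Y : topologicalType}.
Local Notation singular := (singular R Y).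

Definition clamp (a : R) : R := (`|a| - `|a - 1| + 1) / 2.

Lemma clamp_id a : 0 <= a -> a <= 1 -> clamp a = a.
Proof.
move=> a0 a1; rewrite /clamp ger0_norm// distrC ger0_norm ?subr_ge0//.
by field.
Qed.

Lemma clamp_itv a : 0 <= clamp a <= 1.
Proof.
rewrite /clamp; apply/andP; split.
  rewrite divr_ge0// -lerBlDr sub0r lerBrDl.
  by have := ler_normD (a) (- 1); rewrite normrN1 -lerBlDr.
rewrite ler_pdivrMr// mul1r -lerBrDr (_ : 2 - 1 = 1 :> R) ?lerBlDr; last by ring.
by have := ler_normD 1 (a - 1); rewrite addrC subrK normr1.
Qed.

Lemma clamp_continuous : continuous clamp.
Proof.
move=> a; apply: cvgMr_tmp; apply: cvgD; last exact: cvg_cst.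
apply: cvgB; apply: cvg_norm; first exact: cvg_id.
by apply: cvgB; [exact: cvg_id|exact: cvg_cst].
Qed.

Lemma edge_point_subproof (a : R) :
  \row_(j < 2) (if j == ord0 then 1 - clamp a else clamp a) \in simplex R 1.
Proof.
have /andP[c0 c1] := clamp_itv a.
rewrite inE; split=> [j|]; last by rewrite big_ord_recl big_ord1 !mxE/= subrK.
by rewrite mxE; case: ifP; rewrite // subr_ge0.
Qed.

Definition edge_point (a : R) : simplex R 1 := SigSub (edge_point_subproof a).

Lemma edge_point_continuous : continuous edge_point.
Proof.
apply: continuous_set_type; apply: continuous_row => j.
rewrite (_ : (fun _ => _) = if j == ord0 then (fun a => 1 - clamp a) else clamp).
  by case: ifP => _ a; [apply: cvgB; [exact: cvg_cst|]|]; exact: clamp_continuous.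
by apply/funext => a; rewrite /= mxE; case: ifP.
Qed.

Lemma edge_point_coord (t : simplex R 1) :
  edge_point (set_val t ord0 ord_max) = t.
Proof.
have t0 := simplex_ge0 t; have := simplex_sum t.
rewrite big_ord_recl big_ord1 (_ : lift _ _ = ord_max); last exact/val_inj.
move=> t1; apply: val_inj => /=; apply/rowP => j; rewrite mxE clamp_id//; last first.
  by rewrite -t1 lerDr.
case: eqP => [->|/eqP j0]; first by rewrite -t1 addrK.
by congr (val t _ _); apply/val_inj; case: j j0 => -[|[|]].
Qed.

Lemma edge_point0 : edge_point 0 = vertex ord0.
Proof. by rewrite -[RHS]edge_point_coord coord_vertex. Qed.

Lemma edge_point1 : edge_point 1 = vertex ord_max.
Proof. by rewrite -[RHS]edge_point_coord coord_vertex. Qed.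

Lemma concat_paths (s1 s2 : singular 1) :
  s1 (vertex ord_max) = s2 (vertex ord0) ->
  exists K : singular 2,
    pullback (lift ord_max) K = s1 /\ pullback (lift ord0) K = s2.
Proof.
move=> s12.
pose h (t : simplex R 2) : R := set_val t ord0 ord_max - set_val t ord0 ord0.
have ch : continuous h.
  have c j : continuous (fun t : simplex R 2 => set_val t ord0 j).
    by apply: continuous_coord; exact: continuous_set_val.
  by move=> t; exact: (cvgB (c _ t) (c _ t)).
have ce : continuous (fun t => edge_point (h t)).
  move=> t; exact: (@continuous_comp _ _ _ h edge_point t (ch t)
    (@edge_point_continuous _)).
have ce1 : continuous (fun t => edge_point (1 + h t)).
  move=> t; apply: (@continuous_comp _ _ _ (fun t => 1 + h t) edge_point).
    exact: (cvgD (@cvg_cst _ _ _ _ _) (ch t)).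
  exact: edge_point_continuous.
have cK := @continuous_paste R _ _ h (fun t => s1 (edge_point (1 + h t)))
  (fun t => s2 (edge_point (h t))) ch.
have {}cK : continuous (fun t => if h t <= 0 then s1 (edge_point (1 + h t))
    else s2 (edge_point (h t))).
  apply: cK => [t|t|t ->].
  - exact: (@continuous_comp _ _ _ (fun t => edge_point (1 + h t)) s1 t (ce1 t)
      (@cts_fun _ _ s1 _)).
  - exact: (@continuous_comp _ _ _ (fun t => edge_point (h t)) s2 t (ce t)
      (@cts_fun _ _ s2 _)).
  - by rewrite addr0 edge_point0 edge_point1.
have coord (i : 'I_3) (j : 'I_3) (t : simplex R 1) :
    set_val (simplex_map (lift i) t) ord0 j =
    (if lift i ord0 == j then set_val t ord0 ord0 else 0) +
    (if lift i ord_max == j then set_val t ord0 ord_max else 0).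
  rewrite mxE big_mkcond big_ord_recl big_ord1.
  by rewrite (_ : lift ord0 ord0 = ord_max :> 'I_2)//; exact/val_inj.
exists (mkcts cK); split; apply/continuousEP => t; rewrite /pullback /= /mkcts /h.
all: rewrite !coord /= ?addr0 ?add0r.
- rewrite oppr_le0 simplex_ge0 -{1}(simplex_sum t) big_ord_recl big_ord1.
  rewrite addrAC subrr add0r -[in RHS](edge_point_coord t).
  by congr (s1 (edge_point (set_val t _ _))); exact/val_inj.
- rewrite subr0 -[in RHS](edge_point_coord t).
  case: ifP => // t0; have {}t0 : set_val t ord0 ord_max = 0.
    by apply/eqP; rewrite eq_le t0 simplex_ge0.
  by rewrite t0 addr0 edge_point0 edge_point1.
Qed.

Lemma loopless_coboundary (c : @cochain R Y 1) : cobound c = 0 ->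
  (forall s, is_loop s -> c s = 0) -> is_coboundary c.
Proof.
move=> c0 cl.
pose from_to x y (s : singular 1) := s (vertex ord0) = x /\ s (vertex ord_max) = y.
have concat x y z s1 s2 : from_to x y s1 -> from_to y z s2 ->
    exists2 s, from_to x z s & c s = c s1 + c s2.
  move=> [s1x s1y] [s2y s2z].
  have [|K [K1 K2]] := @concat_paths s1 s2; first by rewrite s1y s2y.
  exists (pullback (lift (lift ord0 ord0)) K).
    rewrite /from_to -s1x -s2z -K1 -K2 /pullback /= !simplex_map_vertex.
    by split; congr (K (vertex _)); exact/val_inj.
  have := congr1 (@^~ K) c0; rewrite /cobound !big_ord_recl big_ord0 addr0.
  rewrite (_ : lift ord0 (lift ord0 ord0) = ord_max); last exact/val_inj.
  by rewrite K1 K2 addrCA => /addF2_eq0 ->; rewrite addrC.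
have rev x y s : from_to x y s -> exists2 s', from_to y x s' & c s' = c s.
  move=> sxy; pose s' := pullback (@rev_ord 2) s; exists s'.
    rewrite /from_to /s' /pullback /= !simplex_map_vertex.
    by case: sxy => <- <-; split; congr (s (vertex _)); exact/val_inj.
  have [|s'' [s''x s''x'] s''E] := concat x y x s s' sxy.
    rewrite /from_to /s' /pullback /= !simplex_map_vertex.
    by case: sxy => <- <-; split; congr (s (vertex _)); exact/val_inj.
  apply/esym/addF2_eq0; rewrite -s''E; apply: cl.
  by rewrite /is_loop s''x s''x'.
pose conn x y := exists s, from_to x y s.
have connxx x : conn x x.
  by exists (mkcts (@cst_continuous _ _ x)).
have connC x y : conn x y -> conn y x.
  by move=> [s sxy]; have [s' ? _] := rev _ _ _ sxy; exists s'.
have connT x y z : conn x y -> conn y z -> conn x z.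
  by move=> [s sxy] [s' s'yz]; have [s'' ? _] := concat _ _ _ _ _ sxy s'yz; exists s''.
pose base y := xget y [set x | conn x y].
have baseP y : conn (base y) y 
  by apply: (@xgetPex _ y [set x | conn x y]); exists y; exact: connxx.
have base_eq x y : conn x y -> base x = base y.
  move=> xy; have E : [set z | conn z x] = [set z | conn z y].
    apply/seteqP; split=> z /= zc; first exact: connT zc xy.
    exact: connT zc (connC _ _ xy).
  rewrite /base E /xget; case: pselect => // -[]; exists y.
  by apply/asboolP; exact: connxx.
pose p y := sval (cid (baseP y)).
have pP y : from_to (base y) y (p y) by exact: (svalP (cid (baseP y))).
exists (fun s => c (p (s (vertex ord0)))); apply/funext => s.
rewrite /cobound big_ord_recl big_ord1 /pullback /= !simplex_map_vertex.
rewrite (_ : lift ord0 ord0 = ord_max); last exact/val_inj.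
rewrite (_ : lift ord_max ord0 = ord0); last exact/val_inj.
set x := s (vertex ord0); set y := s (vertex ord_max).
have [s1 s1P s1E] := concat _ _ _ _ _ (pP x) (conj erefl erefl : from_to x y s).
have [s2 s2P s2E] := rev _ _ _ (pP y).
have [s3 [s3x s3y] s3E] := concat _ _ _ _ _ s1P s2P.
have : c s3 = 0.
  apply: cl; rewrite /is_loop s3x s3y; apply: base_eq.
  by exists s.
rewrite s3E s1E s2E => /addF2_eq0 <-.
by rewrite addrAC addF2 add0r.
Qed.

End Paths.

(** * The first Stiefel-Whitney class *)

Section DoubleCover.
Context {R : realType} {X : freeZ2Space}.
Local Notation tau := (@z2_act X).
Local Notation Xbar := (orbit_space X).
Local Notation pi := (\pi_Xbar : X -> Xbar).

Lemma act_neq (x : X) : tau x <> x.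
Proof.
move=> xx; have [U sU Ux] := ex_sheet x.
by case: sU => _ /(_ x Ux); rewrite xx.
Qed.

Lemma lift_unique n (l l' : singular R X n) : (forall t, pi (l t) = pi (l' t)) ->
  (forall t, l t = l' t) \/ (forall t, l t = tau (l' t)).
Proof.
move=> ll'; have Ploc (t : simplex R n) : nbhs t [set u | l u = l' u] \/
    nbhs t (~` [set u | l u = l' u]).
  have [U sU Ut] := ex_sheet (l t).
  have nU (k : singular R X n) V : open V -> V (k t) -> nbhs t (k @^-1` V).
    by move=> oV Vt; apply: (@cts_fun _ _ k); exact: open_nbhs_nbhs.
  have nl := nU l U (proj1 sU) Ut.
  have /pi_orbitP[l't|l't] := ll' t; [left|right].
    have nl' : nbhs t (l' @^-1` U) by apply: nU; [case: sU|rewrite l't].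
    by apply: filterS (filterI nl nl') => u [/= Ul Ul']; exact: (sheet_inj sU).
  have sU' := sheet_act sU.
  have nl' : nbhs t (l' @^-1` (tau @^-1` U)).
    by apply: nU; [case: sU'|rewrite l't /= z2_actK].
  apply: filterS (filterI nl nl') => u [/= Ul Ul'] lu; rewrite -lu in Ul'.
  by case: sU => _ /(_ _ Ul).
have [E|E] := pselect (l (vertex ord0) = l' (vertex ord0)); [left|right] => t.
  exact: (@locally_constant _ _ _ Ploc _ t E).
have /pi_orbitP[lt|->] := ll' t; last by rewrite z2_actK.
by case: E; exact: (@locally_constant _ _ _ Ploc t _ (esym lt)).
Qed.

Definition odd_fun (chi : X -> 'F_2) := forall x, chi (tau x) = chi x + 1.

Definition lift_of n (s : singular R Xbar n) : singular R X n :=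
  sval (cid (ex_lift s)).

Lemma lift_ofE n (s : singular R Xbar n) t : pi (lift_of s t) = s t.
Proof. exact: (svalP (cid (ex_lift s))). Qed.

(* Every odd function yields a cocycle representing the first Stiefel-Whitney
   class; the odd function that vanishes on the image of a section of
   [X -> Xbar] gives the classical description of that class. *)
Definition cover_cochain (chi : X -> 'F_2) : @cochain R Xbar 1 :=
  fun s => chi (lift_of s (vertex ord0)) + chi (lift_of s (vertex ord_max)).

Variable chi : X -> 'F_2.
Hypothesis chi_odd : odd_fun chi.

Lemma cover_cochainE (s : singular R Xbar 1) (l : singular R X 1) :
  (forall t, pi (l t) = s t) ->
  cover_cochain chi s = chi (l (vertex ord0)) + chi (l (vertex ord_max)).
Proof.
move=> ls; rewrite /cover_cochain.
have [|E|E] := @lift_unique _ (lift_of s) l.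
- by move=> t; rewrite lift_ofE ls.
- by rewrite !E.
- by rewrite !E !chi_odd addrACA addF2 addr0.
Qed.

Lemma cobound_cover_cochain : cobound (cover_cochain chi) = 0.
Proof.
apply/funext => s; pose l := lift_of s.
have E (i : 'I_3) : cover_cochain chi (pullback (lift i) s) =
    chi (l (vertex (lift i ord0))) + chi (l (vertex (lift i ord_max))).
  rewrite (@cover_cochainE _ (pullback (lift i) l)) => [|t].
    by rewrite /pullback /= !simplex_map_vertex.
  by rewrite /pullback /= lift_ofE.
rewrite /cobound !big_ord_recl big_ord0 !E.
pose a (i : 'I_3) := chi (l (vertex i)).
transitivity (a (inord 1) + a (inord 2) + (a (inord 0) + a (inord 2) +
    (a (inord 0) + a (inord 1) + 0))).
  by congr (chi (l (vertex _)) + chi (l (vertex _)) +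
     (chi (l (vertex _)) + chi (l (vertex _)) +
     (chi (l (vertex _)) + chi (l (vertex _)) + 0)));
     apply/val_inj; rewrite /= inordK.
move: (a _) (a _) (a _) => x y z.
by case: (F2P x) (F2P y) (F2P z) => -> [] -> [] ->; apply/val_inj.
Qed.

End DoubleCover.
Arguments cover_cochain R {X} chi.

Section StiefelWhitneyClass.
Context {R : realType} {X : freeZ2Space}.
Local Notation tau := (@z2_act X).
Local Notation Xbar := (orbit_space X).
Local Notation pi := (\pi_Xbar : X -> Xbar).

Definition section_fun (x : X) : 'F_2 := if x == repr (pi x) then 0 else 1.

Lemma section_fun_odd : odd_fun section_fun.
Proof.
move=> x; rewrite /section_fun pi_act.
have /pi_orbitP[->|->] : pi x = pi (repr (pi x)) by rewrite pi_surj.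
  by rewrite eqxx; case: eqP => [/act_neq//|]; rewrite add0r.
rewrite eqxx; case: eqP => [/esym/act_neq//|].
by rewrite addF2.
Qed.

Lemma cobound_loop (b : @cochain R Xbar 0) s : is_loop s -> cobound b s = 0.
Proof.
move=> sl; rewrite /cobound big_ord_recl big_ord1.
rewrite (_ : pullback (lift ord0) s = pullback (lift (lift ord0 ord0)) s).
  exact: addF2.
apply/continuousEP => t; rewrite /pullback /=.
rewrite [t]simplex0_eq !simplex_map_vertex.
rewrite (_ : lift ord0 ord0 = ord_max); last exact/val_inj.
by rewrite (_ : lift ord_max ord0 = ord0); last exact/val_inj.
Qed.

Lemma is_w1_cover_cochain (chi : X -> 'F_2) (s : singular R Xbar 1) :
  odd_fun chi -> is_loop s ->
  cover_cochain R chi s = if `[< lifts_to_loop s >] then 0 else 1.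
Proof.
move=> co sl; case: asboolP => [[l ll ls]|nl].
  by rewrite (cover_cochainE co (l := l))// ll addF2.
rewrite /cover_cochain; set l := lift_of s.
have /pi_orbitP[E|->] : pi (l (vertex ord0)) = pi (l (vertex ord_max)).
  by rewrite !lift_ofE.
  by case: nl; exists l => [|t]; [exact: esym E|exact: lift_ofE].
by rewrite co addrA addF2 add0r.
Qed.

Lemma w1_cover_cochain (chi : X -> 'F_2) : odd_fun chi ->
  cohomologous (val (repr (w1 R X))) (cover_cochain R chi).
Proof.
move=> co; have w1P : is_w1 (w1 R X).
  pose z : cocycle 1 := Cocycle (introT eqP (cobound_cover_cochain (R := R) co)).
  apply: (xgetPex 0); exists (\pi_(cohomology R Xbar 1) z) => s sl.
  rewrite -(is_w1_cover_cochain co sl).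
  have : repr (\pi_(cohomology R Xbar 1) z) - z \in @coboundary R Xbar 1.
    by rewrite Quotient.idealrBE reprK.
  rewrite unfold_in => /asboolP[b /(congr1 (@^~ s))].
  by rewrite cobound_loop// => /eqP; rewrite subr_eq0 => /eqP.
apply: loopless_coboundary.
  rewrite raddfD /= cobound_cover_cochain// addr0.
  exact/eqP/(cocycleP (repr (w1 R X))).
move=> s sl; rewrite -[LHS]/(val (repr (w1 R X)) s + cover_cochain R chi s).
by rewrite w1P// (is_w1_cover_cochain co sl) addF2.
Qed.

Lemma w1_exp_eq0 m (chi : nat -> X -> 'F_2) : (forall i, odd_fun (chi i)) ->
  cohomology_exp (w1 R X) m = 0 <->
  is_coboundary (cup_prod m (fun i => cover_cochain R (chi i))).
Proof.
move=> co; apply: cohomology_exp_eq0 => i; first exact: cobound_cover_cochain.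
exact: w1_cover_cochain.
Qed.

End StiefelWhitneyClass.

(** * The upper bound *)

Section Pull.
Context {R : realType} {Y Y' : topologicalType}.
Variable f : continuousType Y Y'.

Definition pull n (c : @cochain R Y' n) : @cochain R Y n :=
  fun s => c (f \o s).

Lemma pullback_comp_map m n (g : 'I_m.+1 -> 'I_n.+1) (s : singular R Y n) :
  pullback g (f \o s) = f \o pullback g s.
Proof. by apply/continuousEP. Qed.

Lemma cobound_pull n (c : @cochain R Y' n) : cobound (pull c) = pull (cobound c).
Proof.
apply/funext => s; apply: eq_bigr => i _.
by rewrite /pull -pullback_comp_map.
Qed.

Lemma is_coboundary_pull n (c : @cochain R Y' n) :
  is_coboundary c -> is_coboundary (pull c).
Proof.
case: n c => [|n] c /=; first by move=> ->.
by move=> [b ->]; exists (pull b); rewrite cobound_pull.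
Qed.

Lemma cup_prod_pull m (c : nat -> @cochain R Y' 1) :
  cup_prod m (fun i => pull (c i)) = pull (cup_prod m c).
Proof.
elim: m c => // m IH c /=.
apply/funext => s; rewrite /pull/= /cup !pullback_comp_map.
congr (_ * _); exact: (congr1 (@^~ _) (IH (c \o S))).
Qed.

End Pull.

Lemma eq_cup_prod (R : realType) (Y : topologicalType) m
    (c c' : nat -> @cochain R Y 1) :
  (forall i, (i < m)%N -> c i = c' i) -> cup_prod m c = cup_prod m c'.
Proof.
elim: m c c' => // m IH c c' cc' /=.
by rewrite cc'// (IH (c \o S) (c' \o S))// => i im; exact: cc'.
Qed.

Lemma small_is_coboundary (R : realType) (Y : topologicalType) I
    (U : I -> set Y) n (c : @cochain R Y n) :
  (forall i, open (U i)) -> (forall y, exists i, U i y) -> cobound c = 0 ->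
  (forall s, is_small U s -> c s = 0) -> is_coboundary c.
Proof.
case: n c => [|n] c oU cU c0 cs; last first.
  by apply: (@small_coboundary R Y I U) => // s; rewrite c0.
apply/funext => s; apply: cs; have [i Ui] := cU (s (vertex ord0)).
by exists i => t; rewrite [t]simplex0_eq.
Qed.

Section Equivariant.
Context {R : realType} {X X' : freeZ2Space}.
Variable f : X -> X'.
Hypothesis f_cont : continuous f.
Hypothesis f_equiv : forall x, f (z2_act x) = z2_act (f x).

Definition orbit_map (q : orbit_space X) : orbit_space X' :=
  \pi_(orbit_space X') (f (repr q)).

Lemma orbit_map_pi x :
  orbit_map (\pi_(orbit_space X) x) = \pi_(orbit_space X') (f x).
Proof.
rewrite /orbit_map; have : \pi_(orbit_space X) (repr (\pi_(orbit_space X) x)) =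
  \pi_(orbit_space X) x by rewrite pi_surj.
by move/pi_orbitP => [<-//|xE]; rewrite [in RHS]xE f_equiv pi_act.
Qed.

Lemma orbit_map_continuous : continuous orbit_map.
Proof.
apply/quotient_continuous.
rewrite (_ : _ \o _ = \pi_(orbit_space X') \o f); last first.
  by apply/funext => x /=; rewrite orbit_map_pi.
by move=> x; apply: continuous_comp; [exact: f_cont|exact: pi_continuous].
Qed.

Lemma w1_exp_equivariant m :
  cohomology_exp (w1 R X') m = 0 -> cohomology_exp (w1 R X) m = 0.
Proof.
pose F : continuousType (orbit_space X) (orbit_space X') :=
  mkcts orbit_map_continuous.
pose G : continuousType X X' := mkcts f_cont.
have co := @section_fun_odd X'.
move/(w1_exp_eq0 m (fun=> co)) => H.
have co' : odd_fun (@section_fun X' \o f) by move=> x; rewrite /= f_equiv co.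
apply/(w1_exp_eq0 m (fun=> co')).
have -> : cover_cochain R (@section_fun X' \o f) =
    pull F (cover_cochain R (@section_fun X')).
  apply/funext => s; rewrite /pull.
  rewrite (cover_cochainE co (l := G \o lift_of s)) => [|t] //.
  by rewrite /= /F /mkcts -[s t]lift_ofE orbit_map_pi.
by rewrite cup_prod_pull; exact: is_coboundary_pull.
Qed.

End Equivariant.

Section UpperBound.
Context {R : realType} {X : freeZ2Space} {n : nat}.
Local Notation S := (sphere R n).
Local Notation Y := (balanced_product R X n).
Local Notation pib := (\pi_(balanced_space R X n) : X * S -> balanced_space R X n).
Local Notation Ybar := (orbit_space Y).
Local Notation Xbar := (orbit_space X).
Local Notation coord y i := (set_val y ord0 i).

Lemma pib_open (W : set (X * S)) : open W -> open (pib @` W).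
Proof.
pose sigma (p : X * S) : X * S := (z2_act p.1, sphere_left p.2).
have csigma : continuous sigma.
  apply: continuous_prod_map; first exact: z2_act_continuous.
  exact: sphere_left_continuous.
move=> oW; rewrite /open/= /quotient_open.
rewrite (_ : _ @^-1` _ = W `|` sigma @^-1` W).
  by apply: openU => //; move/continuousP: csigma; apply.
apply/seteqP; split=> p /=.
  move=> [r Wr /esym/pi_balancedP[<-|rE]]; [by left|right].
  by rewrite /sigma -rE.
case=> Wp; first by exists p.
by exists (sigma p) => //; apply/esym/pi_balancedP; right.
Qed.

Definition base_map0 (e : balanced_space R X n) : Xbar :=
  \pi_Xbar (repr e).1.

Lemma base_map0_pi p : base_map0 (pib p) = \pi_Xbar p.1.
Proof.
rewrite /base_map0; have : pib (repr (pib p)) = pib p by exact: reprK.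
by move/pi_balancedP => [<-//|pE]; rewrite [in RHS]pE pi_act.
Qed.

Definition base_map (e : Ybar) : Xbar := base_map0 (repr e).

Lemma base_map_pi (e : Y) : base_map (\pi_Ybar e) = base_map0 e.
Proof.
rewrite /base_map; have : \pi_Ybar (repr (\pi_Ybar e)) = \pi_Ybar e by rewrite pi_surj.
move/pi_orbitP => [<-//|eE]; rewrite [in RHS]eE.
elim/balanced_ind: (repr _) => x y.
by rewrite [z2_act _]balanced_act_pi !base_map0_pi.
Qed.

Lemma base_map_continuous : continuous base_map.
Proof.
apply/quotient_continuous.
rewrite (_ : _ \o _ = base_map0); last by apply/funext => e /=; rewrite base_map_pi.
apply/quotient_continuous.
rewrite (_ : _ \o _ = \pi_Xbar \o fst); last first.
  by apply/funext => e /=; rewrite base_map0_pi.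
by move=> x; apply: continuous_comp; [exact: cvg_fst|exact: pi_continuous].
Qed.

Definition sgF2 (a : R) : 'F_2 := if a < 0 then 1 else 0.

Lemma sgF2N a : a != 0 -> sgF2 (- a) = sgF2 a + 1.
Proof.
by rewrite /sgF2 oppr_lt0 => a0; case: ltgtP a0 => // _ _; exact/val_inj.
Qed.

Lemma sgF2_eq a b : 0 < a * b -> sgF2 a = sgF2 b.
Proof.
rewrite /sgF2; case: (ltgtP a 0) => [a0|a0|->]; last by rewrite mul0r ltxx.
  by rewrite nmulr_rgt0// => ->.
by rewrite pmulr_rgt0// => b0; rewrite ltNge (ltW b0).
Qed.

(* The sign of the [i]-th coordinate; for [i = 0] it changes under the left
   action, which the odd function on [X] compensates. *)
Definition coord_fun (i : 'I_n.+1) (e : Y) : 'F_2 :=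
  let p := repr (e : balanced_space R X n) in
  if coord p.2 i != 0 then
    (if i == ord0 then section_fun p.1 else 0) + sgF2 (coord p.2 i)
  else section_fun e.

Lemma coord_left i (y : S) : coord (sphere_left y) i =
  if i == ord0 then - coord y i else coord y i.
Proof. by rewrite mxE. Qed.

Lemma coord_right i (y : S) : coord (sphere_right y) i = - coord y i.
Proof. by rewrite mxE. Qed.

Lemma coord_fun_pi i (x : X) (y : S) : coord y i != 0 ->
  coord_fun i (pib (x, y)) =
  (if i == ord0 then section_fun x else 0) + sgF2 (coord y i).
Proof.
move=> yi; have : pib (repr (pib (x, y))) = pib (x, y) by exact: reprK.
rewrite /coord_fun; move: (repr _) => [x' y'].
move/pi_balancedP => [[<- <-]|[xE yE]] /=; first by rewrite yi.
have : coord y i = coord (sphere_left y') i by rewrite yE.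
rewrite coord_left; move: yi => /[swap] E; rewrite E.
case: (i == ord0) => yi.
  rewrite oppr_eq0 in yi; rewrite yi xE section_fun_odd sgF2N//.
  by rewrite addrACA addF2 addr0.
by rewrite yi.
Qed.

Lemma coord_fun_pi0 i (x : X) (y : S) : coord y i = 0 ->
  coord_fun i (pib (x, y)) = section_fun (pib (x, y) : Y).
Proof.
move=> yi; have : pib (repr (pib (x, y))) = pib (x, y) by exact: reprK.
rewrite /coord_fun; move: (repr _) => [x' y'].
move/pi_balancedP => [[<- <-]|[xE yE]] /=; first by rewrite yi eqxx.
have : coord y i = coord (sphere_left y') i by rewrite yE.
rewrite coord_left yi; case: (i == ord0); last by move=> <-; rewrite eqxx.
by move=> /eqP; rewrite eq_sym oppr_eq0 => ->.
Qed.

Lemma coord_fun_odd i : odd_fun (coord_fun i).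
Proof.
move=> e; elim/balanced_ind: e => x y.
rewrite [z2_act _]balanced_act_pi.
have [yi|yi] := eqVneq (coord y i) 0.
  rewrite !coord_fun_pi0 ?coord_right ?yi ?oppr0// -balanced_act_pi.
  exact: section_fun_odd.
by rewrite !coord_fun_pi ?coord_right ?oppr_eq0// sgF2N// addrA.
Qed.

Definition coord_open (i : 'I_n.+1) : set Ybar :=
  \pi_Ybar @` (pib @` [set p : X * S | coord p.2 i != 0]).

Lemma coord_continuous_sphere i : continuous (fun y : S => coord y i).
Proof. by apply: continuous_coord; exact: continuous_set_val. Qed.

Lemma coord_open_open i : open (coord_open i).
Proof.
apply/(pi_open (X := Y))/pib_open.
have c : continuous (fun p : X * S => coord p.2 i).
  move=> p; apply: (@continuous_comp _ _ _ snd (fun y : S => coord y i)).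
    exact: cvg_snd.
  exact: coord_continuous_sphere.
by move/continuousP: c => /(_ _ (@open_neq R 0)).
Qed.

Lemma coord_open_cover (e : Ybar) : exists i, coord_open i e.
Proof.
rewrite -[e](pi_surj (X := Y)).
elim/balanced_ind: (repr e) => x y.
have [i yi] : exists i, coord y i != 0.
  apply: contrapT => /forallNP y0.
  have /eqP : S (set_val y) by exact: set_valP.
  rewrite big1 1?eq_sym ?oner_eq0// => i _.
  by have /negP/negPn/eqP -> := y0 i; rewrite expr0n.
by exists i; exists (pib (x, y)) => //; exists (x, y).
Qed.

Definition base_proj : continuousType Ybar Xbar := mkcts base_map_continuous.

Definition coord_cochain (i : 'I_n.+1) : @cochain R Ybar 1 :=
  cover_cochain R (coord_fun i) +
  if i == ord0 then pull base_proj (cover_cochain R (@section_fun X)) else 0.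

Lemma coord_cochain_eq0 i (s : singular R Ybar 1) :
  (forall t, coord_open i (s t)) -> coord_cochain i s = 0.
Proof.
move=> si; pose l := lift_of (X := Y) s; pose lx := lift_of (base_proj \o s).
pose phi t := coord_fun i (l t) + if i == ord0 then section_fun (lx t) else 0.
have rep t : exists2 y : S, l t = pib (lx t, y) & coord y i != 0.
  have [x [y [lt yi]]] : exists x y, l t = pib (x, y) /\ coord y i != 0.
    have [_ [[x y] /= yi <-] /esym] := si t.
    rewrite -[s t](lift_ofE (X := Y)) => /esym/(pi_orbitP (X := Y))[lt|lt].
      by exists x, y.
    exists x, (sphere_right y); rewrite coord_right oppr_eq0; split => //.
    by rewrite -balanced_act_pi; exact: lt.
  have /pi_orbitP[xl|xl] : \pi_Xbar x = \pi_Xbar (lx t).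
    rewrite lift_ofE /= /base_proj /mkcts -[s t](lift_ofE (X := Y)) base_map_pi.
    by rewrite -/l lt base_map0_pi.
  - by exists y => //; rewrite xl.
  - exists (sphere_left y); last first.
      by rewrite coord_left; case: ifP => //; rewrite oppr_eq0.
    by rewrite lt; apply/pi_balancedP; right; rewrite xl.
have phiE t y : l t = pib (lx t, y) -> coord y i != 0 ->
    phi t = sgF2 (coord y i).
  move=> lt yi; rewrite /phi lt coord_fun_pi// addrAC.
  by case: ifP => _; rewrite ?addF2 ?addr0 ?add0r.
have phi_loc t : nbhs t [set u | phi u = phi t].
  have [y lt yi] := rep t.
  have [U sU Ut] := ex_sheet (lx t).
  pose B := [set z : S | 0 < coord z i * coord y i].
  have oB : open B.
    have /continuousP : continuous (fun z : S => coord z i * coord y i).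
      move=> z.
      exact: (cvgM (@coord_continuous_sphere i z) (@cvg_cst _ _ _ _ _)).
    by move=> /(_ _ (@open_gt R 0)).
  have oW : open (U `*` B).
    rewrite openE => -[a b] [/= Ua Bb]; exists (U, B) => //=.
    by split; apply: open_nbhs_nbhs; split => //; case: sU.
  have H1 : nbhs t (l @^-1` (pib @` (U `*` B))).
    apply: (@cts_fun _ _ l); apply: open_nbhs_nbhs; split; first exact: pib_open.
    exists (lx t, y); rewrite ?lt//; split => //=.
    by rewrite /B /= -expr2 exprn_even_gt0.
  have H2 : nbhs t (lx @^-1` U).
    by apply: (@cts_fun _ _ lx); apply: open_nbhs_nbhs; split => //; case: sU.
  apply: filterS (filterI H1 H2) => u [/= [[x' y'] [/= Ux' By'] lu] Ulu].
  have [y'' lu' y''i] := rep u.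
  rewrite (phiE _ _ lu' y''i) (phiE _ _ lt yi); apply: sgF2_eq.
  rewrite lu' in lu; case/pi_balancedP: lu => -[lux ->] //.
  by case: sU => _ /(_ _ Ux'); rewrite -lux.
have phi_eq : phi (vertex ord_max) = phi (vertex ord0).
  apply: (@locally_constant R 1 [set t | phi t = phi (vertex ord0)] _
    (vertex ord0)) => // t.
  have [E|/eqP E] := eqVneq (phi t) (phi (vertex ord0)).
    by left; apply: filterS (phi_loc t) => u /=; rewrite E.
  by right; apply: filterS (phi_loc t) => u /= ->.
rewrite -[LHS]/(cover_cochain R (coord_fun i) s + (if i == ord0 then
  pull base_proj (cover_cochain R (@section_fun X)) else 0) s).
transitivity (phi (vertex ord0) + phi (vertex ord_max)).
  rewrite /phi addrACA; congr (_ + _).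
  by case: ifP => _ //; rewrite addr0.
by rewrite phi_eq addF2.
Qed.

Lemma cobound_coord_cochain i : cobound (coord_cochain i) = 0.
Proof.
rewrite /coord_cochain raddfD /=.
rewrite [X in X + _](cobound_cover_cochain (coord_fun_odd i)) add0r.
case: ifP => _; last by rewrite raddf0.
rewrite cobound_pull cobound_cover_cochain//; exact: section_fun_odd.
Qed.

Lemma balanced_exp_eq0 k :
  cohomology_exp (w1 R X) k = 0 -> cohomology_exp (w1 R Y) (n + k) = 0.
Proof.
move/(w1_exp_eq0 k (fun=> @section_fun_odd X)) => wk.
pose T i := cover_cochain R (coord_fun i).
pose w := pull base_proj (cover_cochain R (@section_fun X)).
pose A j i := if (i < n)%N then T (inord i.+1)
  else if (i < n + j)%N then w else T ord0.
have T0 i : cobound (T i) = 0 by apply: cobound_cover_cochain; exact: coord_fun_odd.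
have w0 : cobound w = 0.
  by rewrite cobound_pull cobound_cover_cochain//; exact: section_fun_odd.
have A0 j i : cobound (A j i) = 0 by rewrite /A; case: ifP => // _; case: ifP.
pose chi i := if (i < n)%N then coord_fun (inord i.+1) else coord_fun ord0.
have chi_odd i : odd_fun (chi i) by rewrite /chi; case: ifP => _; exact: coord_fun_odd.
apply/(w1_exp_eq0 _ chi_odd).
have -> : (fun i => cover_cochain R (chi i)) = A 0%N.
  apply/funext => i; rewrite /A /chi addn0.
  by case: ltnP.
suff H j : (j <= k)%N ->
    cohomologous (cup_prod (n + k) (A 0%N)) (cup_prod (n + k) (A j)).
  apply: (cohomologous_coboundary (H k (leqnn _))); apply: cup_prod_tail => //.
  rewrite (@eq_cup_prod _ _ _ _ (fun=> w)); last first.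
    by move=> i ik; rewrite /A ltnNge leq_addr/= ltn_add2l ik.
  by rewrite cup_prod_pull; exact: is_coboundary_pull.
elim: j => [|j IH] jk; first exact: cohomologous_refl.
apply: cohomologous_trans (IH (ltnW jk)) _.
pose B i := if i == (n + j)%N then coord_cochain ord0 else A j i.
rewrite /cohomologous (@cup_prodD _ _ _ _ _ B (n + j)%N); first last.
- rewrite /B eqxx /A ltnNge leq_addr/= ltnn addnS ltnSn.
  by rewrite /coord_cochain eqxx.
- move=> i ij; suff E : A j i = A j.+1 i by rewrite /B (negbTE ij) -E.
  by rewrite /A addnS ltnS [(i <= n + j)%N]leq_eqVlt (negbTE ij).
- by rewrite ltn_add2l.
apply: (@small_is_coboundary _ _ _ coord_open).
- exact: coord_open_open.
- exact: coord_open_cover.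
- apply: cobound_cup_prod => i; rewrite /B; case: ifP => // _.
  exact: cobound_coord_cochain.
move=> s [i si]; have [i0|i0] := eqVneq i ord0.
  apply: (@cup_prod_eq0 _ _ _ _ _ (n + j)%N) => [|f]; first by rewrite ltn_add2l.
  by rewrite /B eqxx; apply: coord_cochain_eq0 => t; rewrite -i0; exact: si.
have ip : (0 < i)%N by rewrite lt0n.
have i_n : (i.-1 < n)%N by rewrite -ltnS prednK.
apply: (@cup_prod_eq0 _ _ _ _ _ i.-1) => [|f].
  exact: leq_trans i_n (leq_addr _ _).
rewrite /B ltn_eqF; last exact: leq_trans i_n (leq_addr _ _).
rewrite /A i_n prednK// inord_val.
have := @coord_cochain_eq0 i (pullback f s) (fun t => si _).
by rewrite /coord_cochain (negbTE i0) addr0.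
Qed.

End UpperBound.

(** * The lower bound *)

Lemma map_enum_lift q (i : 'I_q.+2) :
  [seq lift i j | j <- enum 'I_q.+1] = del i (enum 'I_q.+2).
Proof.
apply: (@eq_from_nth _ ord0).
  by rewrite size_map size_del !size_enum_ord.
move=> j; rewrite size_map size_enum_ord => jq.
rewrite nth_del ?size_enum_ord ?(ltnW (ltn_ord i))//.
rewrite (nth_map ord0) ?size_enum_ord//; apply/val_inj => /=.
by rewrite !nth_enum_ord// /bump; case: (i <= j)%N; rewrite ?add0n ?add1n ?ltnS// ltnW.
Qed.

Section Suspension.
Context {R : realType} {Z Z' : freeZ2Space}.
Variable F : Z * R -> Z'.
Hypothesis F_cont : continuous F.
Hypothesis F0 : forall z, F (z2_act z, 0) = z2_act (F (z, 0)).
Hypothesis F1 : forall z, F (z2_act z, 1) = F (z, 1).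
Variable chi' : Z' -> 'F_2.
Hypothesis chi'_odd : odd_fun chi'.
Hypothesis chi'1 : forall z, chi' (F (z, 1)) = 0.
Local Notation pi := (\pi_(orbit_space Z) : Z -> orbit_space Z).
Local Notation pi' := (\pi_(orbit_space Z') : Z' -> orbit_space Z').
Local Notation simplex := (simplex R).

Section PrismSimplex.
Variables (k : nat) (s : singular R Z k).
Implicit Types l : seq ('I_k.+1 * bool).
Local Notation d0 := (@ord0 k, false).

Definition prism_fun m l (t : simplex m) : Z' :=
  F (s (simplex_map (fun j => (nth d0 l j).1) t),
     weight (fun j => (nth d0 l j).2%:R) t).

Lemma prism_fun_continuous m l : continuous (@prism_fun m l).
Proof.
move=> t; apply: (@continuous_comp _ _ _ (fun t : simplex m =>
  (s (simplex_map (fun j => (nth d0 l j).1) t),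
   weight (fun j => (nth d0 l j).2%:R) t)) F t); last exact: F_cont.
have c1 : {for t, continuous (fun t : simplex m =>
    s (simplex_map (fun j => (nth d0 l j).1) t))}.
  exact: (@cts_fun _ _ (pullback (fun j : 'I_m.+1 => (nth d0 l j).1) s) t).
exact: (cvg_pair c1 (@weight_continuous R m _ t)).
Qed.

Definition prism_lift m l : singular R Z' m := mkcts (@prism_fun_continuous m l).

Lemma prism_liftE m l t : prism_lift m l t =
  F (s (simplex_map (fun j => (nth d0 l j).1) t),
     weight (fun j => (nth d0 l j).2%:R) t).
Proof. by []. Qed.

Lemma orbit_pi_continuous (W : freeZ2Space) :
  continuous (\pi_(orbit_space W) : W -> orbit_space W).
Proof. exact: pi_continuous. Qed.

Definition prism_simplex m l : singular R (orbit_space Z') m :=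
  mkcts (@orbit_pi_continuous Z') \o prism_lift m l.

Lemma prism_simplexE m l t : prism_simplex m l t = pi' (prism_lift m l t).
Proof. by []. Qed.

Lemma prism_simplex_realization : realization d0 prism_simplex.
Proof.
move=> q m f l; apply/continuousEP => t.
rewrite -[LHS]/(prism_simplex m l (simplex_map f t)) !prism_simplexE.
congr (pi' _); rewrite !prism_liftE simplex_map_comp weight_simplex_map.
congr (F (s (simplex_map _ t), weight _ t)); apply/funext => j /=;
  by rewrite (nth_map ord0) ?size_enum_ord// nth_ord_enum.
Qed.

Definition prism_value (x : 'I_k.+1 * bool) : 'F_2 :=
  chi' (F (s (vertex x.1), x.2%:R)).

Lemma prism_simplex_edge x y :
  cover_cochain R chi' (prism_simplex 1 [:: x; y]) =
  prism_value x + prism_value y.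
Proof.
rewrite (cover_cochainE chi'_odd (l := prism_lift 1 [:: x; y]))//.
by rewrite !prism_liftE !weight_vertex !simplex_map_vertex.
Qed.

End PrismSimplex.

Lemma prism_simplex_lift q (s : singular R Z q.+1) (i : 'I_q.+2) m l :
  size l = m.+1 ->
  prism_simplex s m [seq (lift i x.1, x.2) | x <- l] =
  prism_simplex (pullback (lift i) s) m l.
Proof.
move=> lm; apply/continuousEP => t; rewrite !prism_simplexE; congr (pi' _).
rewrite !prism_liftE /pullback /= simplex_map_comp.
congr (F (s (simplex_map _ t), weight _ t)); apply/funext => j /=;
  by rewrite (nth_map (ord0, false))// lm.
Qed.

Definition act_map : continuousType Z Z := mkcts (@z2_act_continuous Z).

(* The dual of the chain map sending a simplex of the orbit space to the prisms
   over its two lifts; their tops agree, and so do their bottoms, so that both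
   cancel in the boundary. *)
Definition prism_sum k m (b : @cochain R (orbit_space Z') m)
    (s : singular R Z k) : 'F_2 :=
  prism (fun l => b (prism_simplex s m l)) (enum 'I_k.+1) +
  prism (fun l => b (prism_simplex (act_map \o s) m l)) (enum 'I_k.+1).

Lemma prism_sum_lift k m (b : @cochain R (orbit_space Z') m)
    (s s' : singular R Z k) : (forall t, pi (s t) = pi (s' t)) ->
  prism_sum b s = prism_sum b s'.
Proof.
case/lift_unique => ss'.
  by have -> : s = s' by exact: singular_ext.
have -> : s = act_map \o s' by exact: singular_ext.
rewrite /prism_sum addrC; congr (_ + _).
have -> // : (act_map \o (act_map \o s') : singular R Z k) = s'.
by apply: singular_ext => t /=; rewrite /mkcts z2_actK.
Qed.

Definition base_fun (z : Z) : 'F_2 := chi' (F (z, 0)).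

Lemma base_fun_odd : odd_fun base_fun.
Proof. by move=> z; rewrite /base_fun F0 chi'_odd. Qed.

Lemma diff_prod_simplex k (s : singular R (orbit_space Z) k) :
  cup_prod k (fun=> cover_cochain R base_fun) s =
  diff_prod (fun i => base_fun (lift_of s (vertex i))) (enum 'I_k.+1).
Proof.
pose r m l := pullback (fun j : 'I_m.+1 => nth (@ord0 k) l j) s.
have rP : realization ord0 r.
  move=> q m f l; rewrite /r pullback_comp; apply: eq_pullback => j /=.
  by rewrite (nth_map ord0) ?size_enum_ord// nth_ord_enum.
rewrite -(cup_prod_realization rP (m := k) (c := cover_cochain R base_fun))//.
- congr (cup_prod _ _ _); apply: singular_ext => t; rewrite /r /pullback /=.
  congr (s _); rewrite -[LHS]mixture_vertices simplex_mapE; congr mixture.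
  by apply/funext => j; rewrite nth_ord_enum.
- move=> x y; pose l := pullback (fun j : 'I_2 => nth (@ord0 k) [:: x; y] j) (lift_of s).
  rewrite (cover_cochainE base_fun_odd (l := l)) => [|t].
    by rewrite /l /pullback /= !simplex_map_vertex.
  by rewrite /l /r /pullback /= lift_ofE.
- by rewrite size_enum_ord.
Qed.

Lemma prism_sum_cup_prod k (s : singular R (orbit_space Z) k) :
  prism_sum (cup_prod k.+1 (fun=> cover_cochain R chi')) (lift_of s) =
  cup_prod k (fun=> cover_cochain R base_fun) s.
Proof.
have P (l : singular R Z k) :
    prism (fun q => cup_prod k.+1 (fun=> cover_cochain R chi')
      (prism_simplex l k.+1 q)) (enum 'I_k.+1) =
    diff_prod (fun i => base_fun (l (vertex i))) (enum 'I_k.+1) *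
    base_fun (l (vertex ord_max)).
  rewrite (@eq_prism _ _ (diff_prod (prism_value l))) => [|q]; last first.
    rewrite size_enum_ord => qk.
    exact: (cup_prod_realization (@prism_simplex_realization _ l)
      (@prism_simplex_edge _ l)).
  have lastE : last ord0 (enum 'I_k.+1) = ord_max.
    by apply/val_inj; rewrite (last_nth ord0) size_enum_ord /= nth_enum_ord.
  have : enum 'I_k.+1 = ord0 :: behead (enum 'I_k.+1) by rewrite enum_ordSl.
  move: (enum _) lastE => q lastE qE; rewrite {1}qE prism_diff_prod; last first.
    by move=> a; exact: chi'1.
  rewrite -qE diff_prod_map; congr (_ * _).
  by move: lastE; rewrite {1}qE /= => ->.
rewrite /prism_sum !P diff_prod_simplex.
have actE t : base_fun ((act_map \o lift_of s : singular R Z k) t) =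
    base_fun (lift_of s t) + 1 by exact: base_fun_odd.
have -> : (fun i => base_fun ((act_map \o lift_of s : singular R Z k) (vertex i))) =
    (fun i => base_fun (lift_of s (vertex i)) + 1) by apply/funext => i; exact: actE.
rewrite diff_prod_shift actE.
by rewrite -mulrDr addrA addF2 add0r mulr1.
Qed.

Lemma prism_sum_cobound k (b : @cochain R (orbit_space Z') k)
    (s : singular R Z k) :
  prism_sum (cobound b) s =
  dl (prism (fun l => b (prism_simplex s k l))) (enum 'I_k.+1) +
  dl (prism (fun l => b (prism_simplex (act_map \o s) k l))) (enum 'I_k.+1).
Proof.
have P (l : singular R Z k) :
    prism (fun q => cobound b (prism_simplex l k.+1 q)) (enum 'I_k.+1) =
    dl (prism (fun q => b (prism_simplex l k q))) (enum 'I_k.+1) +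
    (b (prism_simplex l k (level true (enum 'I_k.+1))) +
     b (prism_simplex l k (level false (enum 'I_k.+1)))).
  rewrite -prism_homotopy; apply: eq_prism => q; rewrite size_enum_ord => qk.
  by rewrite (dl_realization (@prism_simplex_realization _ l)).
have levelE e (l : singular R Z k) t :
    prism_lift l k (level e (enum 'I_k.+1)) t = F (l t, e%:R).
  rewrite prism_liftE.
  congr (F (l _, _)).
    rewrite simplex_mapE -[RHS]mixture_vertices; congr mixture.
    by apply/funext => j; rewrite (nth_map ord0) ?size_enum_ord// nth_ord_enum.
  rewrite /weight -[RHS]mul1r -(simplex_sum t) mulr_suml.
  by apply: eq_bigr => j _; rewrite (nth_map ord0) ?size_enum_ord.
have topE : prism_simplex (act_map \o s) k (level true (enum 'I_k.+1)) =
    prism_simplex s k (level true (enum 'I_k.+1)).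
  apply: singular_ext => t; rewrite !prism_simplexE !levelE /= /mkcts.
  by rewrite F1.
have botE : prism_simplex (act_map \o s) k (level false (enum 'I_k.+1)) =
    prism_simplex s k (level false (enum 'I_k.+1)).
  apply: singular_ext => t; rewrite !prism_simplexE !levelE /= /mkcts.
  by rewrite F0 pi_act.
by rewrite /prism_sum !P topE botE addrACA addF2 addr0.
Qed.

Lemma suspension_exp_eq0 k :
  cohomology_exp (w1 R Z') k.+1 = 0 -> cohomology_exp (w1 R Z) k = 0.
Proof.
move/(w1_exp_eq0 k.+1 (fun=> chi'_odd)) => [b bE].
apply/(w1_exp_eq0 k (fun=> base_fun_odd)).
have E s : cup_prod k (fun=> cover_cochain R base_fun) s =
    prism_sum (cobound b) (lift_of s) by rewrite -prism_sum_cup_prod -bE.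
case: k b bE E => [|k] b bE E.
  apply/funext => s; rewrite E prism_sum_cobound.
  by rewrite !dlE !size_enum_ord !big_ord1 /del enum_ordSl enum_ord0 /= addr0.
exists (fun s => prism_sum b (lift_of s)); apply/funext => s.
rewrite E prism_sum_cobound !dlE !size_enum_ord -big_split.
apply: eq_bigr => i _.
rewrite (@prism_sum_lift _ _ _ _ (pullback (lift i) (lift_of s))); last first.
  by move=> t; rewrite /pullback /= !lift_ofE.
have P (l : singular R Z k.+1) :
    prism (fun q => b (prism_simplex l k.+1 q)) (del i (enum 'I_k.+2)) =
    prism (fun q => b (prism_simplex (pullback (lift i) l) k.+1 q))
      (enum 'I_k.+1).
  rewrite -map_enum_lift prism_map; apply: eq_prism => q.
  by rewrite size_enum_ord => qk; rewrite prism_simplex_lift.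
rewrite !P /prism_sum; congr (_ + _).
have -> // : pullback (lift i) (act_map \o lift_of s) =
  (act_map \o pullback (lift i) (lift_of s) : singular R Z k).
exact: singular_ext.
Qed.

End Suspension.

Section LowerBound.
Context {R : realType} {X : freeZ2Space}.
Local Notation coord y i := (set_val y ord0 i).

Section JoinPole.
Variable n : nat.
Local Notation S := (sphere R n).
Local Notation S' := (sphere R n.+1).
Local Notation Y := (balanced_product R X n).
Local Notation Y' := (balanced_product R X n.+1).
Local Notation pib := (\pi_(balanced_space R X n) : X * S -> balanced_space R X n).
Local Notation pib' :=
  (\pi_(balanced_space R X n.+1) : X * S' -> balanced_space R X n.+1).

Definition join_row (y : S) (s : R) : 'rV[R]_n.+2 :=
  \row_i (if unlift ord_max i is Some j
          then (1 - s ^+ 2) / (1 + s ^+ 2) * coord y j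
          else 2 * s / (1 + s ^+ 2)).

Lemma den_neq0 (s : R) : 1 + s ^+ 2 != 0.
Proof. by rewrite gt_eqF// ltr_pwDl// sqr_ge0. Qed.

Lemma join_row_subproof (y : S) (s : R) : join_row y s \in S'.
Proof.
have yS : S (set_val y) by exact: set_valP.
rewrite inE /sphere /= (bigD1 ord_max)//= mxE unlift_none.
rewrite (reindex_onto (lift ord_max) (fun i => odflt ord0 (unlift ord_max i))) /=; last first.
  by move=> i; case: unliftP => [j ->|->]; rewrite ?eqxx.
rewrite (eq_bigl xpredT) => [|j]; last by rewrite liftK eqxx eq_sym neq_lift.
under eq_bigr do rewrite mxE liftK exprMn.
rewrite -mulr_sumr yS; have := den_neq0 s => ds.
by field.
Qed.

Definition join_pole (y : S) (s : R) : S' := SigSub (join_row_subproof y s).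

Lemma join_pole_left y s :
  join_pole (sphere_left y) s = sphere_left (join_pole y s).
Proof.
apply: val_inj; apply/rowP => i; rewrite !mxE.
case: unliftP => [j ->|->].
  rewrite !set_valE /= !mxE.
  rewrite (_ : (lift ord_max j == ord0) = (j == ord0)); last first.
    by rewrite -!val_eqE /= /bump leqNgt ltn_ord.
  by case: (j == ord0); rewrite ?liftK// mulrN.
by rewrite ?set_valE /= ?mxE ?unlift_none.
Qed.

Lemma coord_join_max y s : coord (join_pole y s) ord_max = 2 * s / (1 + s ^+ 2).
Proof. by rewrite mxE unlift_none. Qed.

Lemma join_pole0 y : join_pole (sphere_right y) 0 = sphere_right (join_pole y 0).
Proof.
apply: val_inj; apply/rowP => i; rewrite !mxE.
case: unliftP => [j _|_]; first by rewrite !set_valE /= !mxE mulrN.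
by rewrite mulr0 mul0r oppr0.
Qed.

Lemma join_pole1 y y' : join_pole y 1 = join_pole y' 1.
Proof.
apply: val_inj; apply/rowP => i; rewrite !mxE.
by case: unliftP => [j _|//]; rewrite expr1n subrr !mul0r.
Qed.

Lemma join_pole_continuous : continuous (fun p : S * R => join_pole p.1 p.2).
Proof.
apply: continuous_set_type; apply: continuous_row => i.
have c2 : continuous (snd : S * R -> R) by move=> p; exact: cvg_snd.
have csq : continuous (fun p : S * R => p.2 ^+ 2).
  by move=> p; exact: (cvgM (c2 p) (c2 p)).
have cden : continuous (fun p : S * R => (1 + p.2 ^+ 2)^-1).
  by move=> p; apply: cvgV; [exact: den_neq0|exact: (cvgD (@cvg_cst _ _ _ _ _) (csq p))].
case: (unliftP ord_max i) => [j|] iE.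
  rewrite (_ : (fun _ => _) = (fun p : S * R =>
    (1 - p.2 ^+ 2) / (1 + p.2 ^+ 2) * coord p.1 j)); last first.
    by apply/funext => p; rewrite /= mxE iE liftK.
  move=> p; apply: cvgM.
    exact: (cvgM (cvgB (@cvg_cst _ _ _ _ _) (csq p)) (cden p)).
  apply: (@continuous_comp _ _ _ fst (fun y : S => coord y j)).
    exact: cvg_fst.
  exact: coord_continuous_sphere.
rewrite (_ : (fun _ => _) = (fun p : S * R => 2 * p.2 / (1 + p.2 ^+ 2))); last first.
  by apply/funext => p; rewrite /= mxE iE unlift_none.
by move=> p; exact: (cvgM (cvgM (@cvg_cst _ _ _ _ _) (c2 p)) (cden p)).
Qed.

Definition fibre_join (p : Y * R) : Y' :=
  let q := repr (p.1 : balanced_space R X n) in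
  pib' (q.1, join_pole q.2 p.2).

Lemma fibre_join_pi x y s : fibre_join (pib (x, y), s) = pib' (x, join_pole y s).
Proof.
rewrite /fibre_join /=; have : pib (repr (pib (x, y))) = pib (x, y) by exact: reprK.
case: (repr _) => x' y' /pi_balancedP[[<- <-]//|[-> ->]] /=.
by apply/pi_balancedP; right; rewrite /= join_pole_left.
Qed.

Lemma fibre_join_continuous : continuous fibre_join.
Proof.
move=> [e s]; elim/balanced_ind: e => x y A /=.
rewrite fibre_join_pi => Axy.
pose G (p : (X * S) * R) : Y' := pib' (p.1.1, join_pole p.1.2 p.2).
have cG : continuous G.
  move=> p; apply: (@continuous_comp _ _ _ (fun p : (X * S) * R =>
    (p.1.1, join_pole p.1.2 p.2)) pib'); last exact: pi_continuous.
  have c1 : {for p, continuous (fun p : (X * S) * R => p.1.1)}.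
    apply: (@continuous_comp _ _ _ fst fst); exact: cvg_fst.
  have c2 : {for p, continuous (fun p : (X * S) * R => join_pole p.1.2 p.2)}.
    apply: (@continuous_comp _ _ _ (fun p : (X * S) * R => (p.1.2, p.2))
      (fun p : S * R => join_pole p.1 p.2)); last exact: join_pole_continuous.
    have c3 : {for p, continuous (fun p : (X * S) * R => p.1.2)}.
      by apply: (@continuous_comp _ _ _ fst snd); [exact: cvg_fst|exact: cvg_snd].
    exact: (cvg_pair c3 cvg_snd).
  exact: (cvg_pair c1 c2).
have [[P Q] [/= Pxy Qs] PQ] : nbhs ((x, y), s) (G @^-1` A) by exact: cG.
move: Pxy; rewrite nbhsE => -[P' [oP' P'xy] P'P].
have Nxy : nbhs (pib (x, y)) (pib @` P').
  by apply: open_nbhs_nbhs; split; [exact: pib_open|exists (x, y)].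
exists (pib @` P', Q) => //=.
move=> [_ s'] [/= [[x' y'] P'x'y' <-] Qs'] /=.
by rewrite /= fibre_join_pi; apply: (PQ ((x', y'), s')); split => //; exact: P'P.
Qed.

Lemma balanced_suspension_exp_eq0 k :
  cohomology_exp (w1 R Y') k.+1 = 0 -> cohomology_exp (w1 R Y) k = 0.
Proof.
apply: (suspension_exp_eq0 fibre_join_continuous _ _
  (@coord_fun_odd R X n.+1 ord_max) _); elim/balanced_ind => x y.
- by rewrite [z2_act _]balanced_act_pi !fibre_join_pi [RHS]balanced_act_pi join_pole0.
- by rewrite [z2_act _]balanced_act_pi !fibre_join_pi (join_pole1 _ y).
- rewrite fibre_join_pi coord_fun_pi coord_join_max; last first.
    by rewrite expr1n mulr1 divff// -(natrD _ 1 1) pnatr_eq0.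
  by rewrite expr1n mulr1 divff ?pnatr_eq0// /sgF2 ltr10 add0r.
Qed.

End JoinPole.

Lemma pole_subproof : const_mx 1 \in sphere R 0.
Proof. by rewrite inE /sphere /= big_ord1 mxE expr1n. Qed.

Lemma balanced0_exp_eq0 k :
  cohomology_exp (w1 R (balanced_product R X 0)) k = 0 ->
  cohomology_exp (w1 R X) k = 0.
Proof.
pose pole : sphere R 0 := SigSub pole_subproof.
pose f (x : X) : balanced_product R X 0 :=
  \pi_(balanced_space R X 0) (x, pole).
apply: (@w1_exp_equivariant R X _ f) => [x|x].
  apply: (@continuous_comp _ _ _ (fun x : X => (x, pole))
    (\pi_(balanced_space R X 0))); last exact: pi_continuous.
  exact: (cvg_pair cvg_id (@cvg_cst _ _ _ _ _)).
rewrite /f [RHS]balanced_act_pi; apply/pi_balancedP; right.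
rewrite /= z2_actK; congr (_, _); apply: val_inj; apply/rowP => i.
by rewrite !mxE ord1 eqxx.
Qed.

Lemma exp_eq0_balanced n k :
  cohomology_exp (w1 R (balanced_product R X n)) (n + k) = 0 ->
  cohomology_exp (w1 R X) k = 0.
Proof.
elim: n => [|n IH]; first exact: balanced0_exp_eq0.
by move/(@balanced_suspension_exp_eq0 n (n + k)).
Qed.

End LowerBound.

Lemma w1_exp0_neq0 (R : realType) (X : freeZ2Space) (x : X) :
  cohomology_exp (w1 R X) 0 <> 0.
Proof.
move/(w1_exp_eq0 0 (fun=> @section_fun_odd X)) => /= E.
pose s : singular R (orbit_space X) 0 :=
  mkcts (@cst_continuous _ _ (\pi_(orbit_space X) x)).
have /eqP : (1 : 'F_2) = 0 := congr1 (fun c : @cochain R (orbit_space X) 0 => c s) E.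
by rewrite oner_eq0.
Qed.

Lemma w1_exp_empty (R : realType) (X : freeZ2Space) m : (X -> False) ->
  cohomology_exp (w1 R X) m = 0.
Proof.
move=> X0; apply/(w1_exp_eq0 m (fun=> @section_fun_odd X)).
have E : cup_prod m (fun=> cover_cochain R (@section_fun X)) = 0.
  by apply/funext => s; case: (X0 (repr (s (vertex ord0)))).
by rewrite E; exact: is_coboundary0.
Qed.

Theorem theorem1p2 (R : realType) (X : freeZ2Space) (n : nat) :
  sw_height R (balanced_product R X n) = (sw_height R X + n%:R%:E)%E.
Proof.
apply/eqP; rewrite eq_le; apply/andP; split.
  apply: ub_ereal_sup => _ [m /eqP Ym <-].
  have [mn|nm] := ltnP m n; last first.
    rewrite -(subnKC nm) natrD EFinD addeC leeD2r//.
    apply: ereal_sup_ubound; exists (m - n)%N => //; apply/eqP => Xm.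
    by apply: Ym; rewrite -(subnKC nm); exact: balanced_exp_eq0.
  have [x _] : exists x : X, True.
    apply: contrapT => X0; apply: Ym; apply: w1_exp_empty.
    by elim/balanced_ind => x _; apply: X0; exists x.
  apply: (@le_trans _ _ (0 + n%:R%:E)%E).
    by rewrite add0e lee_fin ler_nat ltnW.
  rewrite leeD2r//; apply: ereal_sup_ubound; exists 0%N => //.
  by apply/eqP; exact: w1_exp0_neq0.
rewrite -leeBrDr//; apply: ub_ereal_sup => _ [k /eqP Xk <-].
rewrite leeBrDr//; apply: ereal_sup_ubound; exists (n + k)%N.
  by apply/eqP => /exp_eq0_balanced.
by rewrite natrD EFinD addeC.
Qed.
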